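(* Suppose $U$ is a normal measure on a measurable cardinal $\kappa$. Then $\kappa$ is $\Pi^1_\xi$-indescribable for all $\xi<\kappa^+$, and the set \[X=\{\alpha<\kappa:\ \alpha\text{ is }\Pi^1_\xi\text{-indescribable for all }\xi<\alpha^+\}\] is in $U$.
   Context: Canonical functions. For every regular cardinal $\kappa$ and every ordinal $\xi$ with $\kappa\le\xi<\kappa^+$ fix a bijection $b_{\kappa,\xi}:\kappa\to\xi$, with $b_{\kappa,\kappa}=\mathrm{id}_\kappa$. For $\xi<\kappa^+$ and $\alpha<\kappa$ let $F^\kappa_\xi(\alpha)=\xi$ if $\xi<\kappa$, and $F^\kappa_\xi(\alpha)=b_{\kappa,\xi}[\alpha]$ if $\kappa\le\xi<\kappa^+$. Let $f^\kappa_\xi(\alpha)=\mathrm{ot}(F^\kappa_\xi(\alpha))$ and let $\pi^\kappa_{\xi,\alpha}:F^\kappa_\xi(\alpha)\to f^\kappa_\xi(\alpha)$ be the transitive collapse (the unique order isomorphism). Formulas. A formula is $\Pi^1_0$ (equivalently $\Sigma^1_0$) over $V_\kappa$ if it is a first-order formula of set theory (only first-order quantifiers) in which free variables and parameters of two types may occur: first-order ones (ranging over, resp. being, elements of $V_\kappa$) and second-order ones (ranging over, resp. being, subsets of $V_\kappa$). It is $\Pi^1_{\xi+1}$ over $V_\kappa$ if it has the form $\forall X_{k_1}\cdots\forall X_{k_m}\psi$ with $\psi$ a $\Sigma^1_\xi$ formula over $V_\kappa$, and $\Sigma^1_{\xi+1}$ if it has the form $\exists X_{k_1}\cdots\exists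 X_{k_m}\psi$ with $\psi$ a $\Pi^1_\xi$ formula over $V_\kappa$ ($m\in\omega$; the quantifiers are second-order, i.e. over subsets of $V_\kappa$). For $\xi$ a limit, a formula with finitely many second-order free variables and finitely many second-order parameters is $\Pi^1_\xi$ over $V_\kappa$ if it has the form $\bigwedge_{\zeta<\xi}\varphi_\zeta$ with each $\varphi_\zeta$ being $\Pi^1_\zeta$ over $V_\kappa$, and $\Sigma^1_\xi$ if it has the form $\bigvee_{\zeta<\xi}\varphi_\zeta$ with each $\varphi_\zeta$ being $\Sigma^1_\zeta$ over $V_\kappa$. Restriction. For $\varphi$ a $\Pi^1_\xi$ or $\Sigma^1_\xi$ formula over $V_\kappa$, $\xi<\kappa^+$, and $\alpha<\kappa$ regular, $\varphi|^\kappa_\alpha$ is defined by recursion on $\xi$. If $\xi<\kappa$, $\varphi|^\kappa_\alpha$ is obtained by replacing each second-order parameter $A_i$ of $\varphi$ by $A_i\cap V_\alpha$. If $\xi=\zeta+1\geq\kappa$, the restriction of $\forall\vec X\psi$ is $\forall\vec X(\psi|^\kappa_\alpha)$ and that of $\exists\vec X\psi$ is $\exists\vec X(\psi|^\kappa_\alpha)$. If $\xi\ge\kappa$ is a limit and $\varphi=\bigwedge_{\zeta<\xi}\psi_\zeta$, then $\varphi|^\kappa_\alpha=\bigwedge_{\zeta<f^\kappa_\xi(\alpha)}\psi_{(\pi^\kappa_{\xi,\alpha})^{-1}(\zeta)}|^\kappa_\alpha$, provided $\psi_{(\pi^\kappa_{\xi,\alpha})^{-1}(\zeta)}|^\kappa_\alpha$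 is a $\Pi^1_\zeta$ formula over $V_\alpha$ for every $\zeta<f^\kappa_\xi(\alpha)$; otherwise $\varphi|^\kappa_\alpha$ is undefined. Similarly for $\Sigma^1_\xi$ formulas with $\bigvee$. Indescribability. For a cardinal $\kappa$ and $\xi<\kappa^+$, a set $S\subseteq\kappa$ is $\Pi^1_\xi$-indescribable (in $\kappa$) if for every $\Pi^1_\xi$ sentence $\varphi$ over $V_\kappa$ (parameters allowed), if $V_\kappa\models\varphi$ then there is some $\alpha\in S$ with $V_\alpha\models\varphi|^\kappa_\alpha$ (which includes that $\varphi|^\kappa_\alpha$ is defined and is a formula over $V_\alpha$). The cardinal $\kappa$ is $\Pi^1_\xi$-indescribable if $S=\kappa$ is. (This notion does not depend on the choice of the bijections $b_{\kappa,\xi}$.) *)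

(* Defs.v *)
(* Vanilla Rocq with the Stdlib classical axioms; no algebra or analysis library is used. *)
From Stdlib Require Import List Classical ClassicalEpsilon
  FunctionalExtensionality PropExtensionality ProofIrrelevance.

Set Implicit Arguments.
Unset Strict Implicit.

(* * The universe of sets

   Aczel's iterative sets modulo extensional equality.  In the presence of
   classical logic and choice this is a model of ZFC with Leibniz equality, whose
   subclasses of sets are sets; it plays the part of the paper's universe. *)

Inductive Ens : Type := sup (A : Type) (f : A -> Ens).

Fixpoint Eqv (x y : Ens) {struct x} : Prop :=
  match x, y with
  | sup f, sup g =>
      (forall a, exists b, Eqv (f a) (g b)) /\ (forall b, exists a, Eqv (f a) (g b))
  end.

Lemma Eqv_refl x : Eqv x x.
Proof. induction x as [A f IH]; simpl; split; intros a; exists a; apply IH. Qed.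

Lemma Eqv_sym x : forall y, Eqv x y -> Eqv y x.
Proof.
  induction x as [A f IH]; intros [B g] [H1 H2]; split.
  - intros b; destruct (H2 b) as [a Ha]; exists a; auto.
  - intros a; destruct (H1 a) as [b Hb]; exists b; auto.
Qed.

Lemma Eqv_trans x : forall y z, Eqv x y -> Eqv y z -> Eqv x z.
Proof.
  induction x as [A f IH]; intros [B g] [C h] [H1 H2] [H3 H4]; split.
  - intros a; destruct (H1 a) as [b Hb]; destruct (H3 b) as [c Hc]; exists c; eauto.
  - intros c; destruct (H4 c) as [b Hb]; destruct (H2 b) as [a Ha]; exists a; eauto.
Qed.

Definition V : Type := {P : Ens -> Prop | exists x, P = Eqv x}.

Definition cls (x : Ens) : V := exist _ (Eqv x) (ex_intro _ x eq_refl).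

Definition rep (x : V) : Ens :=
  proj1_sig (constructive_indefinite_description _ (proj2_sig x)).

Definition mem (x y : V) : Prop :=
  match rep y with sup g => exists b, x = cls (g b) end.

Notation "x ∈ y" := (mem x y) (at level 70, no associativity).
Notation "x ∉ y" := (~ mem x y) (at level 70, no associativity).

Definition sub (x y : V) : Prop := forall z, z ∈ x -> z ∈ y.
Notation "x ⊆ y" := (sub x y) (at level 70, no associativity).

Definition mk (I : Type) (f : I -> V) : V := cls (sup (fun i => rep (f i))).

Lemma cls_eq x y : cls x = cls y <-> Eqv x y.
Proof.
  split; intros H.
  - assert (E : Eqv x = Eqv y) by exact (f_equal (@proj1_sig _ _) H).
    rewrite E; apply Eqv_refl.
  - apply subset_eq_compat; extensionality z; apply propositional_extensionality; split;
      eauto using Eqv_trans, Eqv_sym.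
Qed.

Lemma cls_rep x : cls (rep x) = x.
Proof.
  unfold rep; destruct (constructive_indefinite_description _ _) as [y Hy]; simpl.
  destruct x as [P HP]; simpl in *; apply subset_eq_compat; auto.
Qed.

Lemma mem_cls x A (f : A -> Ens) : x ∈ cls (sup f) <-> exists a, x = cls (f a).
Proof.
  assert (E : Eqv (rep (cls (sup f))) (sup f)) by (apply cls_eq, cls_rep).
  unfold mem; destruct (rep (cls (sup f))) as [B g]; destruct E as [H1 H2]; split.
  - intros [b ->]; destruct (H1 b) as [a Ha]; exists a; apply cls_eq, Ha.
  - intros [a ->]; destruct (H2 a) as [b Hb]; exists b; symmetry; apply cls_eq, Hb.
Qed.

Lemma mem_mk x (I : Type) (f : I -> V) : x ∈ mk f <-> exists i, x = f i.
Proof.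
  unfold mk; rewrite mem_cls; split; intros [i ->]; exists i;
    [apply cls_rep | symmetry; apply cls_rep].
Qed.

Lemma mem_ext x y : (forall z, z ∈ x <-> z ∈ y) -> x = y.
Proof.
  intros H; rewrite <- (cls_rep x), <- (cls_rep y) in *.
  destruct (rep x) as [A f], (rep y) as [B g]; apply cls_eq; split.
  - intros a; assert (Ha : cls (f a) ∈ cls (sup f)) by (apply mem_cls; eauto).
    apply H in Ha; apply mem_cls in Ha; destruct Ha as [b Hb]; exists b; apply cls_eq, Hb.
  - intros b; assert (Hb : cls (g b) ∈ cls (sup g)) by (apply mem_cls; eauto).
    apply H in Hb; apply mem_cls in Hb; destruct Hb as [a Ha]; exists a.
    apply cls_eq; symmetry; exact Ha.
Qed.

Lemma mem_wf : well_founded mem.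
Proof.
  intros x; rewrite <- (cls_rep x); induction (rep x) as [A f IH]; constructor.
  intros y Hy; apply mem_cls in Hy; destruct Hy as [a ->]; apply IH.
Qed.

Definition empty : V := mk (fun e : Empty_set => match e with end).

Definition singleton (x : V) : V := mk (fun _ : unit => x).

Definition sep (x : V) (P : V -> Prop) : V :=
  match rep x with
  | sup g => mk (fun i : {b | P (cls (g b))} => cls (g (proj1_sig i)))
  end.

Definition image (x : V) (f : V -> V) : V :=
  match rep x with sup g => mk (fun b => f (cls (g b))) end.

Definition succ (x : V) : V :=
  match rep x with
  | sup g => mk (fun o => match o with Some b => cls (g b) | None => x end)
  end.

Fixpoint of_nat (n : nat) : V :=
  match n with O => empty | S m => succ (of_nat m) end.

Definition omega : V := mk of_nat.

Lemma mem_empty x : x ∉ empty.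
Proof. unfold empty; rewrite mem_mk; intros [[] _]. Qed.

Lemma mem_singleton y x : y ∈ singleton x <-> y = x.
Proof. unfold singleton; rewrite mem_mk; split; [intros [_ H]; exact H | exists tt; auto]. Qed.

Lemma mem_sep y x P : y ∈ sep x P <-> y ∈ x /\ P y.
Proof.
  unfold sep, mem at 2; destruct (rep x) as [A f]; rewrite mem_mk; split.
  - intros [[b Hb] ->]; simpl; eauto.
  - intros [[b ->] Hb]; exists (exist _ b Hb); reflexivity.
Qed.

Lemma mem_image y x f : y ∈ image x f <-> exists z, z ∈ x /\ y = f z.
Proof.
  unfold image, mem at 2; destruct (rep x) as [A g]; rewrite mem_mk; split.
  - intros [b ->]; eauto.
  - intros [z [[b ->] ->]]; eauto.
Qed.

Lemma mem_succ y x : y ∈ succ x <-> y ∈ x \/ y = x.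
Proof.
  unfold succ, mem at 2; destruct (rep x) as [A g] eqn:E; rewrite mem_mk; split.
  - intros [[b|] ->]; eauto.
  - intros [[b ->] | ->]; [exists (Some b) | exists None]; reflexivity.
Qed.

(* * Ordinals and cardinals

   Von Neumann ordinals, so [α < β] is [α ∈ β] and [α ≤ β] is [α ⊆ β]. Functions
   between sets are given by maps [V -> V] of which only the values on the domain
   matter. *)

Definition transitive (x : V) : Prop := forall y, y ∈ x -> y ⊆ x.

Definition ordinal (x : V) : Prop := transitive x /\ forall y, y ∈ x -> transitive y.

Definition limit (x : V) : Prop :=
  ordinal x /\ x <> empty /\ forall y, y ∈ x -> succ y ∈ x.

Definition bijection (f : V -> V) (A B : V) : Prop :=
  (forall x, x ∈ A -> f x ∈ B) /\
  (forall x y, x ∈ A -> y ∈ A -> f x = f y -> x = y) /\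
  (forall y, y ∈ B -> exists x, x ∈ A /\ f x = y).

Definition cardinal (k : V) : Prop :=
  ordinal k /\ forall a, a ∈ k -> ~ exists f, bijection f a k.

Definition regular (k : V) : Prop :=
  cardinal k /\ omega ⊆ k /\
  forall (a : V) (f : V -> V), a ∈ k -> (forall x, x ∈ a -> f x ∈ k) ->
    exists c, c ∈ k /\ forall x, x ∈ a -> f x ∈ c.

Definition succ_cardinal (k kp : V) : Prop :=
  cardinal kp /\ k ∈ kp /\ forall m, cardinal m -> k ∈ m -> kp ⊆ m.

(* [ξ < κ⁺] *)
Definition lt_plus (xi k : V) : Prop := exists kp, succ_cardinal k kp /\ xi ∈ kp.

(* [inV a x] is [x ∈ V_a], where [V_a] is the union of the power sets of [V_c], [c < a]. *)
Inductive inV : V -> V -> Prop :=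
| inV_intro (a c x : V) : c ∈ a -> (forall y, y ∈ x -> inV c y) -> inV a x.

Definition subV (a A : V) : Prop := forall x, x ∈ A -> inV a x.

(* * Normal measures *)

Definition complete_ultrafilter (k U : V) : Prop :=
  (forall A, A ∈ U -> A ⊆ k) /\
  k ∈ U /\
  empty ∉ U /\
  (forall A B, A ∈ U -> A ⊆ B -> B ⊆ k -> B ∈ U) /\
  (forall A, A ⊆ k -> A ∈ U \/ sep k (fun x => x ∉ A) ∈ U) /\
  (forall (c : V) (A : V -> V), c ∈ k -> (forall x, x ∈ c -> A x ∈ U) ->
     sep k (fun y => forall x, x ∈ c -> y ∈ A x) ∈ U).

Definition nonprincipal (k U : V) : Prop := forall x, x ∈ k -> singleton x ∉ U.

Definition measurable (k : V) : Prop :=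
  cardinal k /\ omega ∈ k /\ exists U, complete_ultrafilter k U /\ nonprincipal k U.

(* The last clause is closure under diagonal intersections. *)
Definition normal_measure (k U : V) : Prop :=
  complete_ultrafilter k U /\ nonprincipal k U /\
  forall A : V -> V, (forall x, x ∈ k -> A x ∈ U) ->
    sep k (fun y => forall x, x ∈ y -> y ∈ A x) ∈ U.

(* * Canonical functions *)

Definition canonical_bijections (b : V -> V -> V -> V) : Prop :=
  (forall k xi, regular k -> k ⊆ xi -> lt_plus xi k -> bijection (b k xi) k xi) /\
  (forall k x, regular k -> x ∈ k -> b k k x = x).

Definition some_such {T : Type} (t : T) (P : T -> Prop) : T := epsilon (inhabits t) P.

(* [p] is an order isomorphism from the set of ordinals [F] onto the ordinal [o]. *)
Definition is_collapse (F o : V) (p : V -> V) : Prop :=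
  ordinal o /\ bijection p F o /\
  forall x y, x ∈ F -> y ∈ F -> (x ∈ y <-> p x ∈ p y).

Definition ot (F : V) : V := some_such empty (fun o => exists p, is_collapse F o p).

Definition collapse (F : V) : V -> V := some_such (fun x => x) (is_collapse F (ot F)).

Definition uncollapse (F z : V) : V :=
  some_such empty (fun x => x ∈ F /\ collapse F x = z).

Section Canonical.
Variable b : V -> V -> V -> V.

Definition canF (k xi a : V) : V :=
  if excluded_middle_informative (xi ∈ k) then xi else image a (b k xi).

Definition canf (k xi a : V) : V := ot (canF k xi a).

Definition canpi_inv (k xi a z : V) : V := uncollapse (canF k xi a) z.

End Canonical.

(* * Formulas

   Variables are named by natural numbers, with separate name spaces for the two
   types; [fIn s T] is the atomic formula [s ∈ T] with [T] a second-order term. *)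

Inductive term : Type := Var (n : nat) | Par (a : V).

Inductive fo : Type :=
| fEq (s t : term)
| fMem (s t : term)
| fIn (s T : term)
| fNot (p : fo)
| fAnd (p q : fo)
| fAll (n : nat) (p : fo).

(* In [Conj xi psi] and [Disj xi psi] only the values [psi z] with [z ∈ xi] matter. *)
Inductive fml : Type :=
| Fo (p : fo)
| All2 (n : nat) (phi : fml)
| Ex2 (n : nat) (phi : fml)
| Conj (xi : V) (psi : V -> fml)
| Disj (xi : V) (psi : V -> fml).

Definition All2s (ns : list nat) (phi : fml) : fml := fold_right All2 phi ns.
Definition Ex2s (ns : list nat) (phi : fml) : fml := fold_right Ex2 phi ns.

Fixpoint fo_par1 (c : V) (p : fo) : Prop :=
  match p with
  | fEq s t | fMem s t => s = Par c \/ t = Par c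
  | fIn s _ => s = Par c
  | fNot q | fAll _ q => fo_par1 c q
  | fAnd q r => fo_par1 c q \/ fo_par1 c r
  end.

Fixpoint fo_par2 (A : V) (p : fo) : Prop :=
  match p with
  | fEq _ _ | fMem _ _ => False
  | fIn _ T => T = Par A
  | fNot q | fAll _ q => fo_par2 A q
  | fAnd q r => fo_par2 A q \/ fo_par2 A r
  end.

Fixpoint fo_free1 (n : nat) (p : fo) : Prop :=
  match p with
  | fEq s t | fMem s t => s = Var n \/ t = Var n
  | fIn s _ => s = Var n
  | fNot q => fo_free1 n q
  | fAnd q r => fo_free1 n q \/ fo_free1 n r
  | fAll m q => n <> m /\ fo_free1 n q
  end.

Fixpoint fo_free2 (n : nat) (p : fo) : Prop :=
  match p with
  | fEq _ _ | fMem _ _ => False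
  | fIn _ T => T = Var n
  | fNot q | fAll _ q => fo_free2 n q
  | fAnd q r => fo_free2 n q \/ fo_free2 n r
  end.

Fixpoint par2 (A : V) (phi : fml) : Prop :=
  match phi with
  | Fo p => fo_par2 A p
  | All2 _ q | Ex2 _ q => par2 A q
  | Conj xi psi | Disj xi psi => exists z, z ∈ xi /\ par2 A (psi z)
  end.

Fixpoint free1 (n : nat) (phi : fml) : Prop :=
  match phi with
  | Fo p => fo_free1 n p
  | All2 _ q | Ex2 _ q => free1 n q
  | Conj xi psi | Disj xi psi => exists z, z ∈ xi /\ free1 n (psi z)
  end.

Fixpoint free2 (n : nat) (phi : fml) : Prop :=
  match phi with
  | Fo p => fo_free2 n p
  | All2 m q | Ex2 m q => n <> m /\ free2 n q
  | Conj xi psi | Disj xi psi => exists z, z ∈ xi /\ free2 n (psi z)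
  end.

Definition sentence (phi : fml) : Prop :=
  forall n, ~ free1 n phi /\ ~ free2 n phi.

Definition fo_over (k : V) (p : fo) : Prop :=
  (forall c, fo_par1 c p -> inV k c) /\ (forall A, fo_par2 A p -> subV k A).

Definition finitely_many {T : Type} (P : T -> Prop) : Prop :=
  exists l : list T, forall x, P x -> In x l.

Definition fin2 (phi : fml) : Prop :=
  finitely_many (fun n => free2 n phi) /\ finitely_many (fun A => par2 A phi).

(* [Pi1 k xi phi]: [phi] is a Π¹_xi formula over [V_k]; likewise [Sigma1]. *)
Inductive Pi1 (k : V) : V -> fml -> Prop :=
| Pi1_zero p : fo_over k p -> Pi1 k empty (Fo p)
| Pi1_succ xi ns psi : Sigma1 k xi psi -> Pi1 k (succ xi) (All2s ns psi)
| Pi1_limit xi psi : limit xi -> fin2 (Conj xi psi) ->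
    (forall z, z ∈ xi -> Pi1 k z (psi z)) -> Pi1 k xi (Conj xi psi)
with Sigma1 (k : V) : V -> fml -> Prop :=
| Sigma1_zero p : fo_over k p -> Sigma1 k empty (Fo p)
| Sigma1_succ xi ns psi : Pi1 k xi psi -> Sigma1 k (succ xi) (Ex2s ns psi)
| Sigma1_limit xi psi : limit xi -> fin2 (Disj xi psi) ->
    (forall z, z ∈ xi -> Sigma1 k z (psi z)) -> Sigma1 k xi (Disj xi psi).

Definition formula_over (k : V) (phi : fml) : Prop :=
  exists xi, Pi1 k xi phi \/ Sigma1 k xi phi.

(* * Satisfaction in [V_k] *)

Definition value (e : nat -> V) (t : term) : V :=
  match t with Var n => e n | Par a => a end.

Definition update (e : nat -> V) (n : nat) (a : V) : nat -> V :=
  fun m => if PeanoNat.Nat.eq_dec m n then a else e m.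

Fixpoint fo_sat (k : V) (e1 e2 : nat -> V) (p : fo) : Prop :=
  match p with
  | fEq s t => value e1 s = value e1 t
  | fMem s t => value e1 s ∈ value e1 t
  | fIn s T => value e1 s ∈ value e2 T
  | fNot q => ~ fo_sat k e1 e2 q
  | fAnd q r => fo_sat k e1 e2 q /\ fo_sat k e1 e2 r
  | fAll n q => forall a, inV k a -> fo_sat k (update e1 n a) e2 q
  end.

Fixpoint sat (k : V) (e1 e2 : nat -> V) (phi : fml) : Prop :=
  match phi with
  | Fo p => fo_sat k e1 e2 p
  | All2 n q => forall A, subV k A -> sat k e1 (update e2 n A) q
  | Ex2 n q => exists A, subV k A /\ sat k e1 (update e2 n A) q
  | Conj xi psi => forall z, z ∈ xi -> sat k e1 e2 (psi z)
  | Disj xi psi => exists z, z ∈ xi /\ sat k e1 e2 (psi z)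
  end.

(* Only used for sentences, whose truth does not depend on the assignments. *)
Definition models (k : V) (phi : fml) : Prop :=
  sat k (fun _ => empty) (fun _ => empty) phi.

(* * Restriction *)

Definition cut_term (a : V) (T : term) : term :=
  match T with Var n => Var n | Par A => Par (sep A (inV a)) end.

Fixpoint cut_fo (a : V) (p : fo) : fo :=
  match p with
  | fEq s t => fEq s t
  | fMem s t => fMem s t
  | fIn s T => fIn s (cut_term a T)
  | fNot q => fNot (cut_fo a q)
  | fAnd q r => fAnd (cut_fo a q) (cut_fo a r)
  | fAll n q => fAll n (cut_fo a q)
  end.

Fixpoint cut (a : V) (phi : fml) : fml :=
  match phi with
  | Fo p => Fo (cut_fo a p)
  | All2 n q => All2 n (cut a q)
  | Ex2 n q => Ex2 n (cut a q)
  | Conj xi psi => Conj xi (fun z => cut a (psi z))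
  | Disj xi psi => Disj xi (fun z => cut a (psi z))
  end.

Section Restriction.
Variable b : V -> V -> V -> V.

(* A formula of level [ξ = λ + n], with [λ] zero or a limit, consists of second-order
   quantifiers in front of a first-order formula ([λ = 0]) or of a conjunction or
   disjunction of length [λ].  As [κ] is a limit ordinal whenever there is a regular
   [α < κ], one has [ξ < κ] iff [λ < κ], and the level need not be an argument:
   the distinction between [ξ < κ] and [ξ ≥ κ] can be made after stripping the
   quantifiers, through which [cut] commutes. *)
Fixpoint restr (k a : V) (phi : fml) : fml :=
  match phi with
  | Fo p => cut a (Fo p)
  | All2 n q => All2 n (restr k a q)
  | Ex2 n q => Ex2 n (restr k a q)
  | Conj xi psi =>
      if excluded_middle_informative (xi ∈ k) then cut a (Conj xi psi)
      else Conj (canf b k xi a) (fun z => restr k a (psi (canpi_inv b k xi a z)))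
  | Disj xi psi =>
      if excluded_middle_informative (xi ∈ k) then cut a (Disj xi psi)
      else Disj (canf b k xi a) (fun z => restr k a (psi (canpi_inv b k xi a z)))
  end.

(* Above [k] the canonical functions, hence the restriction, exist for regular [k] only. *)
Fixpoint restr_ok (k a : V) (phi : fml) : Prop :=
  match phi with
  | Fo _ => True
  | All2 _ q | Ex2 _ q => restr_ok k a q
  | Conj xi psi =>
      xi ∈ k \/
      (regular k /\ forall z, z ∈ canf b k xi a ->
         restr_ok k a (psi (canpi_inv b k xi a z)) /\
         Pi1 a z (restr k a (psi (canpi_inv b k xi a z))))
  | Disj xi psi =>
      xi ∈ k \/
      (regular k /\ forall z, z ∈ canf b k xi a ->
         restr_ok k a (psi (canpi_inv b k xi a z)) /\
         Sigma1 a z (restr k a (psi (canpi_inv b k xi a z))))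
  end.

Definition restr_defined (k a : V) (phi : fml) : Prop :=
  a ∈ k /\ regular a /\ restr_ok k a phi.

(* * Indescribability *)

Definition indescribable_set (k xi S : V) : Prop :=
  cardinal k /\ lt_plus xi k /\ S ⊆ k /\
  forall phi, Pi1 k xi phi -> sentence phi -> models k phi ->
    exists a, a ∈ S /\ restr_defined k a phi /\ formula_over a (restr k a phi) /\
      models a (restr k a phi).

Definition indescribable (k xi : V) : Prop := indescribable_set k xi k.

End Restriction.

(* Main.v *)
(* Instead of forming the ultrapower, one proves a Łoś theorem for pairs of ultrafilters.  Let [U]
   be the measure and let [W] be either [U] or the principal ultrafilter at the point [κ]; both are
   κ-complete and satisfy Fodor's pressing-down property.  For a family of Π¹ or Σ¹ formulas
   [φ_k] over [V_k] of levels [ξ_k < k⁺], if [V_k] satisfies [φ_k] for [W]-many [k], then for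
   [U]-many [a] and [W]-many [k] the restriction of [φ_k] to [a] is defined, is a formula over
   [V_a] and holds in [V_a].  This goes by induction on the family [ξ_k] modulo [W], which is
   well-founded by countable completeness.  Subsets [X_k] of [V_k] glue modulo [W] to a single
   subset of [V_κ], which handles the second-order quantifiers, and pressing down along the
   bijections [b k ξ_k] handles the infinite conjunctions and disjunctions.  With [W] principal
   this says that [κ] is indescribable; with [W = U], a [U]-large set of [k] with
   counterexamples [φ_k] would contain a [k] for which [φ_k] does reflect to some [a < k]. *)

From Stdlib Require Import List Lia Classical ClassicalEpsilon
  FunctionalExtensionality.
Require Import Defs.

Set Implicit Arguments.
Unset Strict Implicit.

(** * Sets and ordinals *)

Lemma mem_irrefl x : x ∉ x.
Proof.
  induction x as [x IH] using (well_founded_ind mem_wf); intros H; exact (IH x H H).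
Qed.

Lemma mem_asym x y : x ∈ y -> y ∉ x.
Proof.
  revert y; induction x as [x IH] using (well_founded_ind mem_wf).
  intros y H1 H2; exact (IH y H2 x H2 H1).
Qed.

Lemma no_descending_sequence (s : nat -> V) : ~ forall n, s (S n) ∈ s n.
Proof.
  enough (H : forall x, (exists s : nat -> V, s 0 = x /\ forall n, s (S n) ∈ s n) -> False)
    by (intros Hs; apply (H (s 0)); exists s; auto).
  induction x as [x IH] using (well_founded_ind mem_wf); intros [t [<- Ht]].
  apply (IH (t 1)); [apply Ht | exists (fun n => t (S n)); auto].
Qed.

(** Replacement and union in one step: the index type pairs an index into a representative of [k]
    with an index into a representative of the set it selects. *)
Lemma union_of_family (k : V) (x : V -> V) :
  exists u, forall y, y ∈ u <-> exists i, i ∈ k /\ y ∈ x i.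
Proof.
  set (J := match rep k with sup g =>
    mk (fun p : {i & match rep (x (cls (g i))) with @sup B _ => B end} =>
      match rep (x (cls (g (projT1 p)))) as r return match r with @sup B _ => B end -> V with
      | sup h => fun j => cls (h j) end (projT2 p)) end).
  exists J; intros y; unfold J, mem at 2.
  destruct (rep k) as [A g] eqn:Ek; rewrite mem_mk; split.
  - intros [[i j] ->]; exists (cls (g i)); split; [eauto|].
    simpl; unfold mem; destruct (rep (x (cls (g i)))) as [B h]; eauto.
  - intros [i [[a ->] Hy]].
    enough (H : exists j, y = match rep (x (cls (g a))) as r
        return match r with @sup B _ => B end -> V with sup h => fun j => cls (h j) end j)
      by (destruct H as [j ->]; exists (existT _ a j); reflexivity).
    revert Hy; unfold mem; destruct (rep (x (cls (g a)))) as [B h]; auto.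
Qed.

Lemma sep_ext x y P Q : (forall z, z ∈ x /\ P z <-> z ∈ y /\ Q z) -> sep x P = sep y Q.
Proof. intros H; apply mem_ext; intros z; rewrite !mem_sep; auto. Qed.

Lemma ordinal_mem a x : ordinal a -> x ∈ a -> ordinal x.
Proof. intros [H1 H2] Hx; split; [auto|]; intros y Hy; apply H2, (H1 x Hx), Hy. Qed.

Lemma ordinal_sub a x : ordinal a -> x ∈ a -> x ⊆ a.
Proof. intros [H1 _]; apply H1. Qed.

Lemma ordinal_trichotomy a : forall b, ordinal a -> ordinal b -> a ∈ b \/ a = b \/ b ∈ a.
Proof.
  induction a as [a IHa] using (well_founded_ind mem_wf).
  induction b as [b IHb] using (well_founded_ind mem_wf); intros Ha Hb.
  apply NNPP; intros H; apply H; right; left; apply mem_ext; intros z; split; intros Hz.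
  - destruct (IHa z Hz b (ordinal_mem Ha Hz) Hb) as [h|[->|h]]; [auto|tauto|].
    exfalso; apply H; right; right; exact (ordinal_sub Ha Hz h).
  - destruct (IHb z Hz Ha (ordinal_mem Hb Hz)) as [h|[<-|h]]; [|tauto|auto].
    exfalso; apply H; left; exact (ordinal_sub Hb Hz h).
Qed.

Lemma ordinal_mem_or_sub a b : ordinal a -> ordinal b -> a ∈ b \/ b ⊆ a.
Proof.
  intros Ha Hb; destruct (ordinal_trichotomy Ha Hb) as [h|[->|h]]; auto.
  - right; intros z; auto.
  - right; apply ordinal_sub; auto.
Qed.

Lemma ordinal_succ a : ordinal a -> ordinal (succ a).
Proof.
  intros Ha; split.
  - intros y Hy z Hz; apply mem_succ; left; apply mem_succ in Hy; destruct Hy as [Hy| ->]; auto.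
    exact (ordinal_sub Ha Hy Hz).
  - intros y Hy; apply mem_succ in Hy; destruct Hy as [Hy| ->].
    + exact (proj1 (ordinal_mem Ha Hy)).
    + exact (proj1 Ha).
Qed.

Lemma mem_succ_self a : a ∈ succ a.
Proof. apply mem_succ; auto. Qed.

Lemma succ_inj a c : succ a = succ c -> a = c.
Proof.
  intros E; assert (H1 : a ∈ succ c) by (rewrite <- E; apply mem_succ_self).
  assert (H2 : c ∈ succ a) by (rewrite E; apply mem_succ_self).
  apply mem_succ in H1; apply mem_succ in H2; destruct H1 as [H1|H1], H2 as [H2|H2]; auto.
  destruct (mem_asym H1 H2).
Qed.

Lemma of_nat_inj m n : of_nat m = of_nat n -> m = n.
Proof.
  revert n; induction m as [|m IH]; intros [|n]; simpl; intros E; auto.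
  - destruct (@mem_empty (of_nat n)); rewrite E; apply mem_succ_self.
  - destruct (@mem_empty (of_nat m)); rewrite <- E; apply mem_succ_self.
  - f_equal; apply IH, succ_inj, E.
Qed.

Lemma of_nat_omega n : of_nat n ∈ omega.
Proof. apply mem_mk; eauto. Qed.

Lemma empty_mem_limit x : limit x -> empty ∈ x.
Proof.
  intros [Ho [Hn _]]; apply NNPP; intros H; apply Hn, mem_ext; intros z; split.
  (* An ∈-induction refutes every [z ∈ x]: the elements of [z] would lie in [x] too, so there are
     none, and [z] would be the missing [empty]. *)
  - induction z as [z IH] using (well_founded_ind mem_wf); intros Hz.
    exfalso; apply H; replace empty with z; auto; apply mem_ext; intros y; split; intros Hy.
    + apply IH; auto; exact (ordinal_sub Ho Hz Hy).
    + destruct (mem_empty Hy).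
  - intros Hz; destruct (mem_empty Hz).
Qed.

Lemma inV_iff a x : inV a x <-> exists c, c ∈ a /\ subV c x.
Proof.
  split; [intros [a' c x' Hc Hx]; exists c; auto | intros [c [Hc Hx]]; econstructor; eauto].
Qed.

Lemma inV_mono a c x : a ⊆ c -> inV a x -> inV c x.
Proof. rewrite !inV_iff; intros H [d [Hd Hx]]; eauto. Qed.

Lemma subV_cut k A : subV k (sep A (inV k)).
Proof. intros x; rewrite mem_sep; tauto. Qed.

Lemma cut_cut a k A : a ⊆ k -> sep (sep A (inV k)) (inV a) = sep A (inV a).
Proof.
  intros H; apply sep_ext; intros z; rewrite mem_sep; pose proof (@inV_mono a k z H); tauto.
Qed.

Lemma cut_subV k A : subV k A -> sep A (inV k) = A.
Proof. intros H; apply mem_ext; intros z; rewrite mem_sep; split; [tauto | auto]. Qed.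

(** * Transitive collapses *)

(** The Mostowski collapse by explicit ∈-recursion. [ot] and [collapse] are only given by choice; on
    sets of ordinals they are shown to agree with this map. *)
Definition col (F : V) : V -> V :=
  Fix mem_wf (fun _ => V) (fun x rec =>
    image (sep x (fun y => y ∈ F)) (fun y =>
      match excluded_middle_informative (y ∈ x) with
      | left H => rec y H | right _ => empty end)).

Lemma mem_col F x z : z ∈ col F x <-> exists y, y ∈ x /\ y ∈ F /\ z = col F y.
Proof.
  unfold col at 1; rewrite Fix_eq.
  - fold (col F); rewrite mem_image; split.
    + intros [y [Hy ->]]; apply mem_sep in Hy; exists y.
      destruct (excluded_middle_informative _); tauto.
    + intros [y [Hy [HF ->]]]; exists y; rewrite mem_sep.
      destruct (excluded_middle_informative _); tauto.
  - intros y f g H; f_equal; extensionality w; destruct (excluded_middle_informative _); auto.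
Qed.

Definition ordset (F : V) : Prop := forall x, x ∈ F -> ordinal x.

Lemma col_inj F x y : ordset F -> x ∈ F -> y ∈ F -> col F x = col F y -> x = y.
Proof.
  intros HF Hx Hy E; destruct (ordinal_trichotomy (HF x Hx) (HF y Hy)) as [h|[h|h]]; auto.
  - destruct (@mem_irrefl (col F x)); rewrite E at 2; apply mem_col; eauto.
  - destruct (@mem_irrefl (col F x)); rewrite E at 1; apply mem_col; eauto.
Qed.

Lemma col_transitive F x : ordset F -> ordinal x -> transitive (col F x).
Proof.
  intros HF Hx y Hy z Hz; apply mem_col in Hy; destruct Hy as [u [Hu [HuF ->]]].
  apply mem_col in Hz; destruct Hz as [v [Hv [HvF ->]]].
  apply mem_col; exists v; split; auto; exact (ordinal_sub Hx Hu Hv).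
Qed.

Lemma col_is_collapse F : ordset F -> is_collapse F (image F (col F)) (col F).
Proof.
  intros HF; repeat split.
  - intros y Hy z Hz; apply mem_image in Hy; destruct Hy as [x [Hx ->]].
    apply mem_col in Hz; destruct Hz as [u [Hu [HuF ->]]]; apply mem_image; eauto.
  - intros y Hy; apply mem_image in Hy; destruct Hy as [x [Hx ->]].
    apply col_transitive; auto.
  - intros x Hx; apply mem_image; eauto.
  - intros x y Hx Hy; apply col_inj; auto.
  - intros y Hy; apply mem_image in Hy; destruct Hy as [x [Hx ->]]; eauto.
  - intros Hxy; apply mem_col; eauto.
  - intros Hxy; apply mem_col in Hxy; destruct Hxy as [u [Hu [HuF E]]].
    apply col_inj in E; subst; auto.
Qed.

(** Uniqueness of the collapse: as [o] is transitive and [p] is onto, every element of [p x] is some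
    [p y] with [y ∈ x] in [F], so [p] obeys the recursion of [col]. *)
Lemma is_collapse_col F o p x : is_collapse F o p -> x ∈ F -> p x = col F x.
Proof.
  intros [[Ho _] [[H1 [H2 H3]] H4]]; induction x as [x IH] using (well_founded_ind mem_wf).
  intros Hx; apply mem_ext; intros z; rewrite mem_col; split.
  - intros Hz; destruct (H3 z) as [y [Hy <-]]; [exact (Ho _ (H1 x Hx) z Hz)|].
    apply H4 in Hz; auto; exists y; auto.
  - intros [y [Hyx [Hy ->]]]; rewrite <- IH; auto; exact (proj1 (H4 y x Hy Hx) Hyx).
Qed.

Lemma is_collapse_image F o p : is_collapse F o p -> o = image F (col F).
Proof.
  intros H; apply mem_ext; intros z; rewrite mem_image; split.
  - intros Hz; pose proof H as [_ [[_ [_ H3]] _]]; destruct (H3 z Hz) as [x [Hx <-]].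
    exists x; split; auto; apply (is_collapse_col H Hx).
  - intros [x [Hx ->]]; rewrite <- (is_collapse_col H Hx); destruct H as [_ [[H1 _] _]]; auto.
Qed.

Lemma ot_collapse F : ordset F -> exists p, is_collapse F (ot F) p.
Proof.
  intros HF; unfold ot, some_such.
  apply (epsilon_spec (inhabits empty) (fun o => exists p, is_collapse F o p)).
  exists (image F (col F)), (col F); apply col_is_collapse, HF.
Qed.

Lemma ot_image F : ordset F -> ot F = image F (col F).
Proof. intros HF; destruct (ot_collapse HF) as [p Hp]; exact (is_collapse_image Hp). Qed.

Lemma collapse_col F x : ordset F -> x ∈ F -> collapse F x = col F x.
Proof.
  intros HF; apply (@is_collapse_col F (ot F)); unfold collapse, some_such.
  apply (epsilon_spec (inhabits (fun x : V => x)) (is_collapse F (ot F))), ot_collapse, HF.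
Qed.

Lemma uncollapse_spec F z : ordset F -> z ∈ ot F ->
  uncollapse F z ∈ F /\ col F (uncollapse F z) = z.
Proof.
  intros HF Hz; rewrite ot_image in Hz by auto; apply mem_image in Hz.
  destruct Hz as [x [Hx ->]].
  assert (H : uncollapse F (col F x) ∈ F /\ collapse F (uncollapse F (col F x)) = col F x).
  { unfold uncollapse, some_such.
    apply (epsilon_spec (inhabits empty) (fun y => y ∈ F /\ collapse F y = col F x)).
    exists x; split; auto; apply collapse_col; auto. }
  destruct H as [H1 H2]; split; auto; rewrite <- H2 at 2; symmetry; apply collapse_col; auto.
Qed.

Lemma uncollapse_surj F x : ordset F -> x ∈ F -> exists z, z ∈ ot F /\ uncollapse F z = x.
Proof.
  intros HF Hx; assert (Hz : col F x ∈ ot F)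
    by (rewrite ot_image by auto; apply mem_image; eauto).
  exists (col F x); split; auto; destruct (uncollapse_spec HF Hz) as [H1 H2].
  apply col_inj in H2; auto.
Qed.

(** Below [x] the recursions for [F] and for its initial segment run through the same elements. *)
Lemma ot_initial F x : ordset F -> x ∈ F -> ot (sep F (fun y => y ∈ x)) = col F x.
Proof.
  intros HF Hx; assert (HG : ordset (sep F (fun y => y ∈ x)))
    by (intros y Hy; apply mem_sep in Hy; apply HF, Hy).
  assert (E : forall y, y ∈ x -> col (sep F (fun y => y ∈ x)) y = col F y).
  { intros y; induction y as [y IH] using (well_founded_ind mem_wf); intros Hy.
    apply mem_ext; intros z; rewrite !mem_col; split; intros [u [Hu [HuF ->]]]; exists u.
    - apply mem_sep in HuF; rewrite IH; tauto.
    - assert (Hux : u ∈ x) by exact (ordinal_sub (HF x Hx) Hy Hu).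
      rewrite IH, mem_sep; auto. }
  rewrite ot_image by auto; apply mem_ext; intros z; rewrite mem_image, mem_col; split.
  - intros [y [Hy ->]]; apply mem_sep in Hy; exists y; rewrite E; tauto.
  - intros [y [Hyx [Hy ->]]]; exists y; rewrite mem_sep, E; auto.
Qed.

Lemma ot_ordinal x : ordinal x -> ot x = x.
Proof.
  intros Hx; assert (Hs : ordset x) by (intros y; apply ordinal_mem, Hx).
  rewrite ot_image by auto; symmetry; apply is_collapse_image with (p := fun y => y).
  split; [exact Hx | split; [split; [auto | split; [auto | eauto]] | tauto]].
Qed.

Lemma ot_add_max F x : ordset F -> ordinal x -> (forall y, y ∈ F -> y ∈ succ x) -> x ∈ F ->
  ot F = succ (ot (sep F (fun y => y ∈ x))).
Proof.
  intros HF Ho Hs Hx; rewrite (ot_initial HF Hx), (ot_image HF); apply mem_ext; intros z.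
  rewrite mem_image, mem_succ, mem_col; split.
  - intros [y [Hy ->]]; destruct (proj1 (mem_succ _ _) (Hs y Hy)) as [h| ->]; eauto.
  - intros [[y [_ [Hy ->]]] | ->]; eauto.
Qed.

Lemma ot_limit F : ordset F -> F <> empty -> (forall x, x ∈ F -> succ x ∈ F) -> limit (ot F).
Proof.
  intros HF Hn Hs; destruct (col_is_collapse HF) as [Ho _]; rewrite ot_image by auto.
  split; [auto|split].
  - intros E; apply Hn, mem_ext; intros z; split; intros Hz; [|destruct (mem_empty Hz)].
    destruct (@mem_empty (col F z)); rewrite <- E; apply mem_image; eauto.
  - intros y Hy; apply mem_image in Hy; destruct Hy as [x [Hx ->]].
    assert (Hc : ordinal (col F (succ x)))
      by (refine (ordinal_mem Ho _); apply mem_image; eauto).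
    assert (Hm : col F x ∈ col F (succ x))
      by (apply mem_col; exists x; repeat split; auto using mem_succ_self).
    (* Since [col F x ∈ col F (succ x)], the successor of [col F x] is at most [col F (succ x)] and
       hence lies in the order type. *)
    destruct (ordinal_trichotomy (ordinal_succ (ordinal_mem Hc Hm)) Hc) as [h|[h|h]].
    + refine (ordinal_sub Ho (x := col F (succ x)) _ h); apply mem_image; eauto.
    + rewrite h; apply mem_image; eauto.
    + apply mem_succ in h; destruct h as [h|h].
      * destruct (mem_asym h Hm).
      * rewrite h in Hm; destruct (mem_irrefl Hm).
Qed.

(** * Complete ultrafilters with the pressing-down property *)

(* Besides a normal measure on [κ], this covers the principal ultrafilter at the point [κ]. *)
Record pressing (kappa : V) (W : (V -> Prop) -> Prop) : Prop := {
  pr_ordinal : ordinal kappa;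
  pr_omega : omega ∈ kappa;
  pr_succ : forall a, a ∈ kappa -> succ a ∈ kappa;
  pr_mono : forall P Q : V -> Prop, (forall k, P k -> Q k) -> W P -> W Q;
  pr_and : forall P Q : V -> Prop, W P -> W Q -> W (fun k => P k /\ Q k);
  pr_ultra : forall P : V -> Prop, W P \/ W (fun k => ~ P k);
  pr_false : ~ W (fun _ => False);
  pr_complete : forall c (P : V -> V -> Prop), c ∈ kappa ->
    (forall x, x ∈ c -> W (P x)) -> W (fun k => forall x, x ∈ c -> P x k);
  pr_above : forall c, c ∈ kappa -> W (fun k => c ∈ k);
  pr_below : W (fun k => k ∈ succ kappa);
  pr_regular : W regular;
  pr_press : forall P : V -> V -> Prop, W (fun k => exists c, c ∈ k /\ P c k) ->
    exists c, c ∈ kappa /\ W (P c)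
}.

Section Pressing.
Variables (kappa : V) (W : (V -> Prop) -> Prop).
Hypothesis HW : pressing kappa W.

Lemma W_map (P Q : V -> Prop) : W P -> (forall k, P k -> Q k) -> W Q.
Proof. intros H1 H2; exact (pr_mono HW H2 H1). Qed.

Lemma W_map2 (P Q R : V -> Prop) : W P -> W Q -> (forall k, P k -> Q k -> R k) -> W R.
Proof.
  intros H1 H2 H; refine (W_map (pr_and HW H1 H2) _); intros k [h1 h2]; auto.
Qed.

Lemma W_map3 (P Q R S : V -> Prop) : W P -> W Q -> W R ->
  (forall k, P k -> Q k -> R k -> S k) -> W S.
Proof.
  intros H1 H2 H3 H; refine (W_map2 (pr_and HW H1 H2) H3 _); intros k [h1 h2]; auto.
Qed.

Lemma W_all (P : V -> Prop) : (forall k, P k) -> W P.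
Proof. intros H; refine (W_map (pr_regular HW) _); auto. Qed.

Lemma W_const (P : Prop) : W (fun _ => P) -> P.
Proof.
  intros H; apply NNPP; intros N; apply (pr_false HW); refine (W_map H _); auto.
Qed.

Lemma W_ex (P : V -> Prop) : W P -> exists k, P k.
Proof. intros H; apply W_const; refine (W_map H _); eauto. Qed.

Lemma W_not (P : V -> Prop) : ~ W P -> W (fun k => ~ P k).
Proof. destruct (pr_ultra HW P); tauto. Qed.

Lemma W_not_both (P : V -> Prop) : W P -> W (fun k => ~ P k) -> False.
Proof. intros H1 H2; apply (pr_false HW), (W_map2 H1 H2); auto. Qed.

Lemma W_or (P Q : V -> Prop) : W (fun k => P k \/ Q k) -> W P \/ W Q.
Proof.
  intros H; destruct (pr_ultra HW P) as [h|h]; [auto | right].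
  refine (W_map2 H h _); intros k; tauto.
Qed.

Lemma W_choice (T : Type) (P : V -> T -> Prop) :
  W (fun k => exists t, P k t) -> exists f : V -> T, W (fun k => P k (f k)).
Proof.
  intros H; destruct (W_ex H) as [_ [t0 _]].
  exists (fun k => epsilon (inhabits t0) (P k)); refine (W_map H _).
  intros k; apply epsilon_spec.
Qed.

Lemma W_below : W (fun k => k ⊆ kappa).
Proof.
  refine (W_map (pr_below HW) _); intros k Hk; apply mem_succ in Hk.
  destruct Hk as [Hk| ->]; [exact (ordinal_sub (pr_ordinal HW) Hk) | intros x; auto].
Qed.

Lemma W_omega (P : nat -> V -> Prop) : (forall n, W (P n)) -> W (fun k => forall n, P n k).
Proof.
  intros H; refine (W_map (pr_complete HW
    (P := fun x k => forall n, x = of_nat n -> P n k) (pr_omega HW) _) _).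
  - intros x Hx; apply mem_mk in Hx; destruct Hx as [n ->]; refine (W_map (H n) _).
    intros k Hk m E; apply of_nat_inj in E; subst; auto.
  - intros k Hk n; exact (Hk _ (of_nat_omega n) n eq_refl).
Qed.

(** Dual form of countable completeness. It makes natural-number data of a family constant on a
    large set. *)
Lemma W_nat (P : nat -> V -> Prop) : W (fun k => exists n, P n k) -> exists n, W (P n).
Proof.
  intros H; apply NNPP; intros N; apply (W_not_both H).
  refine (W_map (W_omega (P := fun n k => ~ P n k) _) _).
  - intros n; apply W_not; intros h; apply N; eauto.
  - intros k Hk [n Hn]; exact (Hk n Hn).
Qed.

(** Otherwise each bad [k] would have a witness below it, and pressing down would make one witness
    bad for a large set of [k]. *)
Lemma W_diag (P : V -> V -> Prop) : (forall c, c ∈ kappa -> W (P c)) ->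
  W (fun k => forall c, c ∈ k -> P c k).
Proof.
  intros H; apply NNPP; intros N; apply W_not in N.
  destruct (pr_press HW (P := fun c k => ~ P c k)) as [c [Hc h]].
  - refine (W_map N _); intros k Hk; apply NNPP; intros h; apply Hk; intros c Hc.
    apply NNPP; eauto.
  - exact (W_not_both (H c Hc) h).
Qed.

(** * Limits of families of sets modulo the ultrafilter *)

Lemma W_limit_set (x : V -> V) : exists X, forall y, y ∈ X <-> W (fun k => y ∈ x k).
Proof.
  (* [W] concentrates on [succ kappa], so the union of the [x k] over this set contains every [y]
     that lies in [x k] for [W]-many [k]. *)
  destruct (union_of_family (succ kappa) x) as [u Hu].
  exists (sep u (fun y => W (fun k => y ∈ x k))); intros y; rewrite mem_sep, Hu; split; [tauto|].
  intros H; split; auto; destruct (W_ex (pr_and HW (pr_below HW) H)) as [k Hk]; eauto.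
Qed.

Lemma W_decide_mem (x : V -> V) X : (forall y, y ∈ X <-> W (fun k => y ∈ x k)) ->
  forall y, W (fun k => y ∈ x k <-> y ∈ X).
Proof.
  intros HX y; destruct (pr_ultra HW (fun k => y ∈ x k)) as [h|h]; refine (W_map h _); intros k Hk.
  - split; auto; intros _; apply HX, h.
  - split; [tauto|]; intros Hy; apply HX in Hy; destruct (W_not_both Hy h).
Qed.

(** Extends completeness to index sets V_d without computing their size. If subsets [x k] of V_c
    with c < d were counterexamples, their limit [X] would, by induction, agree with [x k] on all of
    V_c at once; so [x k = X] for many [k], and the fixed set [X] would fail. *)
Lemma W_all_V d (P : V -> V -> Prop) : d ∈ kappa ->
  (forall x, inV d x -> W (P x)) -> W (fun k => forall x, inV d x -> P x k).
Proof.
  revert P; induction d as [d IH] using (well_founded_ind mem_wf); intros P Hd H.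
  refine (W_map (pr_complete HW (P := fun c k => forall x, subV c x -> P x k) Hd _) _).
  - intros c Hc; apply NNPP; intros N; apply W_not in N.
    destruct (W_choice (P := fun k x => subV c x /\ ~ P x k)) as [x Hx].
    { refine (W_map N _); intros k Hk; apply NNPP; intros h; apply Hk; intros x Hx.
      apply NNPP; eauto. }
    destruct (W_limit_set x) as [X HX].
    assert (Hsub : subV c X).
    { intros y Hy; apply HX in Hy; apply W_const; refine (W_map2 Hx Hy _).
      intros k [h _] h'; auto. }
    assert (HcK : c ∈ kappa) by exact (ordinal_sub (pr_ordinal HW) Hd Hc).
    assert (HE := IH c Hc _ HcK (fun y _ => W_decide_mem HX y)).
    apply (W_not_both (H X (proj2 (inV_iff _ _) (ex_intro _ c (conj Hc Hsub))))).
    refine (W_map2 Hx HE _); intros k [h1 h2] h3.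
    replace X with (x k); auto; apply mem_ext; intros z; split; intros Hz.
    + apply h3; auto.
    + apply h3; auto.
  - intros k Hk x Hx; apply inV_iff in Hx; destruct Hx as [c [Hc Hx]]; eauto.
Qed.

Lemma W_some_V d (P : V -> V -> Prop) : d ∈ kappa ->
  W (fun k => exists x, inV d x /\ P x k) -> exists x, inV d x /\ W (P x).
Proof.
  intros Hc H; apply NNPP; intros N; apply (W_not_both H).
  refine (W_map (W_all_V (P := fun x k => ~ P x k) Hc _) _).
  - intros x Hx; apply W_not; intros h; apply N; eauto.
  - intros k Hk [x [Hx HP]]; exact (Hk x Hx HP).
Qed.

Lemma W_some_subV d (P : V -> V -> Prop) : d ∈ kappa ->
  W (fun k => exists x, subV d x /\ P x k) -> exists x, subV d x /\ W (P x).
Proof.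
  intros Hd H; destruct (@W_some_V (succ d) (fun x k => subV d x /\ P x k)) as [x [Hx HP]].
  - apply (pr_succ HW), Hd.
  - refine (W_map H _); intros k [x [h1 h2]]; exists x; repeat split; auto.
    apply inV_iff; exists d; auto using mem_succ_self.
  - exists x; split; [apply (W_const (P := subV d x))|]; refine (W_map HP _); intros k; tauto.
Qed.

(** An element of V_k is a subset of V_c for some c < k. Pressing down fixes c, and completeness
    over V_{c+1} then fixes the element. *)
Lemma W_press_V (P : V -> V -> Prop) : W (fun k => exists x, inV k x /\ P x k) ->
  exists x, inV kappa x /\ W (P x).
Proof.
  intros H; destruct (pr_press HW (P := fun c k => exists x, subV c x /\ P x k)) as [c [Hc h]].
  - refine (W_map H _); intros k [x [Hx HP]]; apply inV_iff in Hx.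
    destruct Hx as [c [Hc Hx]]; eauto.
  - destruct (W_some_subV Hc h) as [x [Hx HP]]; exists x; split; auto.
    apply inV_iff; eauto.
Qed.

Lemma W_diag_V (P : V -> V -> Prop) : (forall x, inV kappa x -> W (P x)) ->
  W (fun k => forall x, inV k x -> P x k).
Proof.
  intros H; apply NNPP; intros N; apply W_not in N.
  destruct (W_press_V (P := fun c k => ~ P c k)) as [c [Hc h]].
  - refine (W_map N _); intros k Hk; apply NNPP; intros h; apply Hk; intros c Hc.
    apply NNPP; eauto.
  - exact (W_not_both (H c Hc) h).
Qed.

Lemma W_inV x : inV kappa x -> W (fun k => inV k x).
Proof.
  intros H; apply inV_iff in H; destruct H as [c [Hc Hx]].
  refine (W_map (pr_above HW Hc) _); intros k Hk; apply inV_iff; eauto.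
Qed.

(** Membership in the limit [X] of the chosen sets is decided for each element of V_κ; the diagonal
    argument decides it for all elements of V_k at once, so the trace of [X] on V_k is the chosen
    set for many [k]. *)
Lemma W_glue (P : V -> V -> Prop) : W (fun k => exists X, subV k X /\ P X k) ->
  exists X, subV kappa X /\ W (fun k => P (sep X (inV k)) k).
Proof.
  intros H; destruct (W_choice (P := fun k X => subV k X /\ P X k) H) as [x Hx].
  destruct (W_limit_set x) as [X HX]; exists X; split.
  - intros y Hy; apply HX in Hy; apply W_const; refine (W_map3 Hx Hy W_below _).
    intros k [h _] h1 h2; apply (inV_mono h2); auto.
  - refine (W_map2 Hx (W_diag_V (fun y _ => W_decide_mem HX y)) _); intros k [h1 h2] h3.
    replace (sep X (inV k)) with (x k); auto; apply mem_ext; intros z; rewrite mem_sep; split.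
    + intros Hz; split; auto; apply h3; auto.
    + intros [Hz Hzk]; apply h3; auto.
Qed.

(** As for well-foundedness of an ultrapower: below a family that is not accessible, dependent
    choice builds an infinite sequence of families, and countable completeness yields one [k] at
    which all their values descend. *)
Lemma W_descent_wf : well_founded (fun x y : V -> V => W (fun k => x k ∈ y k)).
Proof.
  set (R := fun x y : V -> V => W (fun k => x k ∈ y k)).
  intros x; apply NNPP; intros N.
  assert (step : forall y : {y | ~ Acc R y}, exists z : {z | ~ Acc R z},
      R (proj1_sig z) (proj1_sig y)).
  { intros [y Hy]; simpl; apply NNPP; intros h; apply Hy; constructor; intros z Hz.
    apply NNPP; intros Hz'; apply h; exists (exist _ z Hz'); auto. }
  pose (next y := proj1_sig (constructive_indefinite_description _ (step y))).
  pose (s := fix s n := match n with O => exist _ x N | S m => next (s m) end).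
  destruct (W_ex (W_omega (P := fun n k => proj1_sig (s (S n)) k ∈ proj1_sig (s n) k)
    (fun n => proj2_sig (constructive_indefinite_description _ (step (s n)))))) as [k Hk].
  exact (no_descending_sequence (s := fun n => proj1_sig (s n) k) Hk).
Qed.

(** The length and each entry are natural numbers, hence constant on large sets. This fixes the
    bound variables of a quantifier block. *)
Lemma W_list (l : V -> list nat) : exists l0, W (fun k => l k = l0).
Proof.
  destruct (W_nat (P := fun n k => length (l k) = n)) as [n Hn]; [apply W_all; eauto|].
  revert l Hn; induction n as [|n IH]; intros l Hn.
  - exists nil; refine (W_map Hn _); intros k; apply length_zero_iff_nil.
  - destruct (IH (fun k => tl (l k))) as [l1 Hl1].
    { refine (W_map Hn _); intros k; destruct (l k); simpl; lia. }
    destruct (W_nat (P := fun m k => hd 0 (l k) = m)) as [m Hm]; [apply W_all; eauto|].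
    exists (m :: l1); refine (W_map3 Hn Hl1 Hm _); intros k.
    destruct (l k); simpl; [lia | congruence].
Qed.

End Pressing.

(** * First-order formulas *)

Definition cut_env (k : V) (e : nat -> V) : nat -> V := fun n => sep (e n) (inV k).

Lemma cut_env_update k e n X :
  cut_env k (update e n X) = update (cut_env k e) n (sep X (inV k)).
Proof.
  extensionality m; unfold cut_env, update; destruct (PeanoNat.Nat.eq_dec m n); auto.
Qed.

Lemma cut_fo_cut_fo a k p : a ⊆ k -> cut_fo a (cut_fo k p) = cut_fo a p.
Proof.
  intros H; induction p as [| |s T|p IH|p IHp q IHq|n p IH]; simpl; try congruence.
  destruct T as [n|A]; simpl; auto; rewrite cut_cut; auto.
Qed.

Lemma fo_par2_cut a A p :
  fo_par2 A (cut_fo a p) -> exists A', fo_par2 A' p /\ A = sep A' (inV a).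
Proof.
  induction p as [| |s T|p IH|p IHp q IHq|n p IH]; simpl; try tauto.
  - destruct T as [n|B]; simpl; intros E; [discriminate|]; inversion E; eauto.
  - intros [h|h]; [destruct (IHp h) as [B HB] | destruct (IHq h) as [B HB]]; exists B; tauto.
Qed.

Lemma fo_par1_cut a c p : fo_par1 c (cut_fo a p) <-> fo_par1 c p.
Proof. induction p; simpl; tauto. Qed.

Lemma fo_free2_cut a n p : fo_free2 n (cut_fo a p) <-> fo_free2 n p.
Proof.
  induction p as [| |s T|p IH|p IHp q IHq|m p IH]; simpl; try tauto.
  destruct T as [m|B]; simpl; [tauto | split; discriminate].
Qed.

Lemma fo_over_and k p q : fo_over k (fAnd p q) <-> fo_over k p /\ fo_over k q.
Proof. unfold fo_over; simpl; firstorder. Qed.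

Definition fo_holds (s : bool) (k : V) (e1 e2 : nat -> V) (p : fo) : Prop :=
  if s then fo_sat k e1 e2 p else ~ fo_sat k e1 e2 p.

(** A measure for induction on a family of formulas whose shape varies with [k], where structural
    induction does not apply. *)
Fixpoint fo_size (p : fo) : nat :=
  match p with
  | fEq _ _ | fMem _ _ | fIn _ _ => 0
  | fNot q | fAll _ q => S (fo_size q)
  | fAnd q r => S (fo_size q + fo_size r)
  end.

Section FirstOrder.
Variables (kappa : V) (W : (V -> Prop) -> Prop).
Hypothesis HW : pressing kappa W.

Definition env_over (e1 e2 : nat -> V) : Prop :=
  forall n, inV kappa (e1 n) /\ subV kappa (e2 n).

Lemma env_over_update1 e1 e2 n a :
  env_over e1 e2 -> inV kappa a -> env_over (update e1 n a) e2.
Proof.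
  intros H Ha m; split; [|apply H]; unfold update.
  destruct (PeanoNat.Nat.eq_dec m n); auto; apply H.
Qed.

Lemma env_over_update2 e1 e2 n A :
  env_over e1 e2 -> subV kappa A -> env_over e1 (update e2 n A).
Proof.
  intros H Ha m; split; [apply H|]; unfold update.
  destruct (PeanoNat.Nat.eq_dec m n); auto; apply H.
Qed.

Lemma W_fo_over p : fo_over kappa p -> W (fun k => fo_over k (cut_fo k p)).
Proof.
  intros [H1 _].
  assert (HT : forall t, (forall c, t = Par c -> inV kappa c) ->
      W (fun k => forall c, t = Par c -> inV k c)).
  { intros [n|a] Ht; [apply (W_all HW); discriminate|].
    refine (W_map HW (W_inV HW (Ht a eq_refl)) _); intros k Hk c E; inversion E; subst; auto. }
  (* Cutting makes all second-order parameters subsets of V_k; it remains to place the finitely many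
     first-order ones in V_k. *)
  enough (H : W (fun k => forall c, fo_par1 c p -> inV k c)).
  { refine (W_map HW H _); intros k Hk; split.
    - intros c Hc; apply fo_par1_cut in Hc; auto.
    - intros A HA; apply fo_par2_cut in HA; destruct HA as [A' [_ ->]]; apply subV_cut. }
  induction p as [s t|s t|s T|p IH|p IHp q IHq|n p IH]; simpl in *; auto.
  - refine (W_map2 HW (HT s _) (HT t _) _); auto; intros k h1 h2 c [h|h]; auto.
  - refine (W_map2 HW (HT s _) (HT t _) _); auto; intros k h1 h2 c [h|h]; auto.
  - refine (W_map2 HW (IHp _) (IHq _) _); auto; intros k h1 h2 c [h|h]; auto.
Qed.

(** A true universal statement passes to V_k by diagonalising over its instances; a falsifying
    instance in V_κ lies in V_k for many [k]. Carrying both signs [s] lets the induction pass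
    through negations. *)
Lemma fo_los p : fo_over kappa p -> forall s e1 e2, env_over e1 e2 ->
  fo_holds s kappa e1 e2 p ->
  W (fun k => fo_holds s k e1 (cut_env k e2) (cut_fo k p)).
Proof.
  induction p as [t u|t u|t T|p IH|p IHp q IHq|n p IH]; intros Hp s e1 e2 He H.
  - apply (W_all HW); intros k; destruct s; exact H.
  - apply (W_all HW); intros k; destruct s; exact H.
  - assert (Ht : inV kappa (value e1 t)).
    { destruct t as [n|a]; simpl; [apply He | apply Hp; simpl; auto]. }
    refine (W_map HW (W_inV HW Ht) _); intros k Hk.
    assert (E : value e1 t ∈ value (cut_env k e2) (cut_term k T)
      <-> value e1 t ∈ value e2 T).
    { destruct T as [n|A]; simpl; unfold cut_env; rewrite mem_sep; tauto. }
    destruct s; simpl in *; tauto.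
  - refine (W_map HW (IH Hp (negb s) e1 e2 He _) _); [|intros k]; destruct s; simpl in *; tauto.
  - apply fo_over_and in Hp; destruct Hp as [Hp Hq]; destruct s; simpl in H.
    + refine (W_map2 HW (IHp Hp true e1 e2 He _) (IHq Hq true e1 e2 He _) _); simpl; tauto.
    + apply not_and_or in H; destruct H as [H|H].
      * refine (W_map HW (IHp Hp false e1 e2 He H) _); intros k; simpl; tauto.
      * refine (W_map HW (IHq Hq false e1 e2 He H) _); intros k; simpl; tauto.
  - destruct s; simpl in H.
    + refine (W_map HW (W_diag_V HW (P := fun a k =>
        fo_holds true k (update e1 n a) (cut_env k e2) (cut_fo k p)) _) _).
      * intros a Ha; exact (IH Hp true _ _ (env_over_update1 n He Ha) (H a Ha)).
      * intros k Hk; exact Hk.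
    + apply not_all_ex_not in H; destruct H as [a H].
      apply imply_to_and in H; destruct H as [Ha H].
      refine (W_map2 HW (W_inV HW Ha) (IH Hp false _ _ (env_over_update1 n He Ha) H) _).
      intros k h1 h2 h; exact (h2 (h a h1)).
Qed.

Lemma fo_los_conv p : fo_over kappa p -> forall s e1 e2, env_over e1 e2 ->
  W (fun k => fo_holds s k e1 (cut_env k e2) (cut_fo k p)) ->
  fo_holds s kappa e1 e2 p.
Proof.
  intros Hp s e1 e2 He H; apply NNPP; intros N.
  assert (N' : fo_holds (negb s) kappa e1 e2 p) by (destruct s; simpl in *; tauto).
  apply (pr_false HW), (W_map2 HW H (fo_los Hp He N')); intros k; destruct s; simpl; tauto.
Qed.

Lemma W_term1 (t : V -> term) : W (fun k => forall c, t k = Par c -> inV k c) ->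
  exists t0, (forall c, t0 = Par c -> inV kappa c) /\ W (fun k => t k = t0).
Proof.
  intros H; destruct (W_or HW (P := fun k => exists n, t k = Var n)
    (Q := fun k => exists a, t k = Par a)) as [h|h].
  - apply (W_all HW); intros k; destruct (t k); eauto.
  - destruct (W_nat HW h) as [n Hn]; exists (Var n); split; [discriminate | auto].
  - destruct (W_press_V HW (P := fun a k => t k = Par a)) as [a [Ha Hk]].
    + refine (W_map2 HW H h _); intros k h1 [a Hk]; exists a; auto.
    + exists (Par a); split; auto; intros c E; inversion E; subst; auto.
Qed.

(** Subsets of V_k need not be constant on a large set; gluing yields one subset of V_κ of which
    they are the traces. *)
Lemma W_term2 (T : V -> term) : W (fun k => forall A, T k = Par A -> subV k A) ->
  exists T0, (forall A, T0 = Par A -> subV kappa A) /\ W (fun k => T k = cut_term k T0).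
Proof.
  intros H; destruct (W_or HW (P := fun k => exists n, T k = Var n)
    (Q := fun k => exists a, T k = Par a)) as [h|h].
  - apply (W_all HW); intros k; destruct (T k); eauto.
  - destruct (W_nat HW h) as [n Hn]; exists (Var n); split; [discriminate | auto].
  - destruct (W_glue HW (P := fun A k => T k = Par A)) as [A [HA Hk]].
    + refine (W_map2 HW H h _); intros k h1 [A Hk]; exists A; auto.
    + exists (Par A); split; auto; intros B E; inversion E; subst; auto.
Qed.

(** The size and the outermost symbol are constant for many [k]; terms are pressed down or glued,
    and subformulas are handled by induction on the size. *)
Lemma W_fo (p : V -> fo) : W (fun k => fo_over k (p k)) ->
  exists p0, fo_over kappa p0 /\ W (fun k => p k = cut_fo k p0).
Proof.
  destruct (W_nat HW (P := fun n k => fo_size (p k) = n)) as [n Hn];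
    [apply (W_all HW); eauto|].
  revert p Hn; induction n as [n IH] using (well_founded_ind PeanoNat.Nat.lt_wf_0).
  intros p Hn H.
  assert (IH' : forall q : V -> fo, W (fun k => fo_size (q k) < n /\ fo_over k (q k)) ->
      exists q0, fo_over kappa q0 /\ W (fun k => q k = cut_fo k q0)).
  { intros q Hq; destruct (W_nat HW (P := fun m k => fo_size (q k) = m)) as [m Hm];
      [apply (W_all HW); eauto|].
    apply (IH m); auto.
    - apply (W_const HW); refine (W_map2 HW Hq Hm _); intros k; lia.
    - refine (W_map HW Hq _); tauto. }
  clear IH.
  pose proof (pr_and HW Hn H) as G; clear Hn H.
  assert (C : W (fun k => (exists st, p k = fEq (fst st) (snd st)) \/
      (exists st, p k = fMem (fst st) (snd st)) \/ (exists st, p k = fIn (fst st) (snd st)) \/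
      (exists q, p k = fNot q) \/ (exists q, p k = fAnd (fst q) (snd q)) \/
      (exists m q, p k = fAll m q))).
  { apply (W_all HW); intros k; destruct (p k) as [s t|s t|s t|q|q r|m q];
      [left; exists (s, t) | right; left; exists (s, t) | right; right; left; exists (s, t)
      | do 3 right; left; exists q | do 4 right; left; exists (q, r)
      | do 5 right; exists m, q]; reflexivity. }
  repeat (apply (W_or HW) in C; destruct C as [C|C]).
  - apply (W_choice HW) in C; destruct C as [st Hst].
    pose proof (pr_and HW G Hst) as G'.
    destruct (@W_term1 (fun k => fst (st k))) as [s [Hs1 Hs2]].
    { refine (W_map HW G' _); intros k [[_ h] E] c Ec; rewrite E in h; apply h; simpl; auto. }
    destruct (@W_term1 (fun k => snd (st k))) as [t [Ht1 Ht2]].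
    { refine (W_map HW G' _); intros k [[_ h] E] c Ec; rewrite E in h; apply h; simpl; auto. }
    exists (fEq s t); split.
    + split; simpl; [intros c [h|h]; auto | tauto].
    + refine (W_map3 HW Hst Hs2 Ht2 _); intros k E <- <-; auto.
  - apply (W_choice HW) in C; destruct C as [st Hst].
    pose proof (pr_and HW G Hst) as G'.
    destruct (@W_term1 (fun k => fst (st k))) as [s [Hs1 Hs2]].
    { refine (W_map HW G' _); intros k [[_ h] E] c Ec; rewrite E in h; apply h; simpl; auto. }
    destruct (@W_term1 (fun k => snd (st k))) as [t [Ht1 Ht2]].
    { refine (W_map HW G' _); intros k [[_ h] E] c Ec; rewrite E in h; apply h; simpl; auto. }
    exists (fMem s t); split.
    + split; simpl; [intros c [h|h]; auto | tauto].
    + refine (W_map3 HW Hst Hs2 Ht2 _); intros k E <- <-; auto.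
  - apply (W_choice HW) in C; destruct C as [st Hst].
    pose proof (pr_and HW G Hst) as G'.
    destruct (@W_term1 (fun k => fst (st k))) as [s [Hs1 Hs2]].
    { refine (W_map HW G' _); intros k [[_ h] E] c Ec; rewrite E in h; apply h; simpl; auto. }
    destruct (@W_term2 (fun k => snd (st k))) as [t [Ht1 Ht2]].
    { refine (W_map HW G' _); intros k [[_ h] E] c Ec; rewrite E in h; apply h; simpl; auto. }
    exists (fIn s t); split.
    + split; simpl; auto.
    + refine (W_map3 HW Hst Hs2 Ht2 _); intros k E <-; simpl; intros <-; auto.
  - apply (W_choice HW) in C; destruct C as [q Hq].
    destruct (IH' q) as [q0 [h1 h2]].
    { refine (W_map2 HW G Hq _); intros k [Hk h] E; rewrite E in Hk, h; simpl in Hk.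
      split; [lia | exact h]. }
    exists (fNot q0); split; [exact h1|].
    refine (W_map2 HW Hq h2 _); intros k E E'; simpl; congruence.
  - apply (W_choice HW) in C; destruct C as [q Hq].
    pose proof (pr_and HW G Hq) as G'.
    destruct (IH' (fun k => fst (q k))) as [q0 [h1 h2]].
    { refine (W_map HW G' _); intros k [[Hk h] E]; rewrite E in Hk, h; simpl in Hk.
      apply fo_over_and in h; split; [lia | tauto]. }
    destruct (IH' (fun k => snd (q k))) as [r0 [h3 h4]].
    { refine (W_map HW G' _); intros k [[Hk h] E]; rewrite E in Hk, h; simpl in Hk.
      apply fo_over_and in h; split; [lia | tauto]. }
    exists (fAnd q0 r0); split; [apply fo_over_and; auto|].
    refine (W_map3 HW Hq h2 h4 _); intros k E E' E''; simpl; congruence.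
  - apply (W_choice HW) in C; destruct C as [m C]; apply (W_choice HW) in C.
    destruct C as [q Hq].
    destruct (W_nat HW (P := fun n k => m k = n)) as [i Hi]; [apply (W_all HW); eauto|].
    destruct (IH' q) as [q0 [h1 h2]].
    { refine (W_map2 HW G Hq _); intros k [Hk h] E; rewrite E in Hk, h; simpl in Hk.
      split; [lia | exact h]. }
    exists (fAll i q0); split; [exact h1|].
    refine (W_map3 HW Hq h2 Hi _); intros k E E' E''; simpl; congruence.
Qed.

End FirstOrder.

(** * Canonical functions modulo the ultrafilters *)

Lemma lt_plus_ordinal xi k : lt_plus xi k -> ordinal xi.
Proof. intros [kp [[[Hk _] _] Hxi]]; exact (ordinal_mem Hk Hxi). Qed.

Lemma lt_plus_mem xi k z : lt_plus xi k -> z ∈ xi -> lt_plus z k.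
Proof.
  intros [kp [Hk Hxi]] Hz; exists kp; split; auto.
  exact (ordinal_sub (proj1 (proj1 Hk)) Hxi Hz).
Qed.

Lemma regular_ordinal k : regular k -> ordinal k.
Proof. intros H; apply H. Qed.

Section CanonicalFunctions.
Variable b : V -> V -> V -> V.
Hypothesis Hb : canonical_bijections b.

Lemma canF_sub k xi a : regular k -> lt_plus xi k -> a ⊆ k -> canF b k xi a ⊆ xi.
Proof.
  intros Hk Hxi Ha z; unfold canF; destruct (excluded_middle_informative _) as [h|h]; auto.
  intros Hz; apply mem_image in Hz; destruct Hz as [c [Hc ->]].
  destruct (ordinal_mem_or_sub (lt_plus_ordinal Hxi) (regular_ordinal Hk)) as [|h']; [tauto|].
  apply (proj1 Hb k xi Hk h' Hxi); auto.
Qed.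

Lemma canF_ordset k xi a : regular k -> lt_plus xi k -> a ⊆ k -> ordset (canF b k xi a).
Proof.
  intros Hk Hxi Ha x Hx; apply canF_sub in Hx; auto.
  exact (ordinal_mem (lt_plus_ordinal Hxi) Hx).
Qed.

Lemma canF_small k xi a : xi ∈ k -> canF b k xi a = xi.
Proof. intros H; unfold canF; destruct (excluded_middle_informative _); tauto. Qed.

Lemma canf_small k xi a : regular k -> xi ∈ k -> canf b k xi a = xi.
Proof.
  intros Hk H; unfold canf; rewrite canF_small by auto.
  apply ot_ordinal, (ordinal_mem (regular_ordinal Hk) H).
Qed.

Variables (kappa : V) (U W : (V -> Prop) -> Prop).
Hypotheses (HU : pressing kappa U) (HW : pressing kappa W).
Hypothesis U_kappa : U (fun a => a ∈ kappa).

(* [UW P] only sees pairs with [a < k], by [UW_mem]. *)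
Definition UW (P : V -> V -> Prop) : Prop := U (fun a => W (fun k => P k a)).

Lemma UW_map (P Q : V -> V -> Prop) : UW P -> (forall k a, P k a -> Q k a) -> UW Q.
Proof.
  intros H1 H2; refine (W_map HU H1 _); intros a h; refine (W_map HW h _); auto.
Qed.

Lemma UW_and (P Q : V -> V -> Prop) : UW P -> UW Q -> UW (fun k a => P k a /\ Q k a).
Proof. intros H1 H2; refine (W_map2 HU H1 H2 _); intros a; apply (pr_and HW). Qed.

Lemma UW_map2 (P Q R : V -> V -> Prop) : UW P -> UW Q ->
  (forall k a, P k a -> Q k a -> R k a) -> UW R.
Proof. intros H1 H2 H; refine (UW_map (UW_and H1 H2) _); intros k a [h1 h2]; auto. Qed.

Lemma UW_map3 (P Q R S : V -> V -> Prop) : UW P -> UW Q -> UW R ->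
  (forall k a, P k a -> Q k a -> R k a -> S k a) -> UW S.
Proof.
  intros H1 H2 H3 H; refine (UW_map2 (UW_and H1 H2) H3 _); intros k a [h1 h2]; auto.
Qed.

Lemma UW_of_W (P : V -> Prop) : W P -> UW (fun k _ => P k).
Proof. intros H; apply (W_all HU); auto. Qed.

Lemma UW_of_U (P : V -> Prop) : U P -> UW (fun _ a => P a).
Proof. intros H; refine (W_map HU H _); intros a h; apply (W_all HW); auto. Qed.

Lemma UW_mem : UW (fun k a => a ∈ k /\ a ⊆ k).
Proof.
  refine (W_map HU U_kappa _); intros a Ha.
  refine (W_map2 HW (pr_above HW Ha) (pr_regular HW) _); intros k h Hk; split; auto.
  exact (ordinal_sub (regular_ordinal Hk) h).
Qed.

Definition adm (xi : V -> V) : Prop := W (fun k => lt_plus (xi k) k).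

Lemma adm_mem xi z : adm xi -> W (fun k => z k ∈ xi k) -> adm z.
Proof. intros H1 H2; refine (W_map2 HW H1 H2 _); intros k; apply lt_plus_mem. Qed.

(** Matches the two clauses in the definition of the canonical functions; levels below [k] press
    down to a constant. *)
Lemma adm_cases xi : adm xi ->
  (exists x, x ∈ kappa /\ W (fun k => xi k = x)) \/ W (fun k => k ⊆ xi k).
Proof.
  intros H; destruct (pr_ultra HW (fun k => xi k ∈ k)) as [h|h]; [left|right].
  - apply (pr_press HW (P := fun x k => xi k = x)); refine (W_map HW h _); eauto.
  - refine (W_map3 HW H h (pr_regular HW) _); intros k h1 h2 h3.
    destruct (ordinal_mem_or_sub (lt_plus_ordinal h1) (regular_ordinal h3)); tauto.
Qed.

(** Reduces a statement about all members of the canonical sets to single families. Above [k] the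
    members are the values [b k (xi k) c] with [c < a]: each fixed [c] gives one family, [U] is
    diagonalised over [c < a], and completeness of [W] over [a < κ] collects the results. *)
Lemma UW_canF xi (P : V -> V -> V -> Prop) : adm xi ->
  (forall x, W (fun k => x k ∈ xi k) -> UW (fun k a => P k a (x k))) ->
  UW (fun k a => forall x, x ∈ canF b k (xi k) a -> P k a x).
Proof.
  intros Hxi H; destruct (adm_cases Hxi) as [[xi0 [Hx0 E]]|Hge].
  - assert (G : U (fun a => forall x, x ∈ xi0 -> W (fun k => P k a x))).
    { apply (pr_complete HU (P := fun x a => W (fun k => P k a x)) Hx0); intros x Hx.
      apply (H (fun _ => x)); refine (W_map HW E _); intros k ->; auto. }
    refine (W_map HU G _); intros a Ha.
    refine (W_map3 HW (pr_complete HW (P := fun x k => P k a x) Hx0 Ha) E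
      (pr_above HW Hx0) _).
    intros k h -> h' x Hx; rewrite canF_small in Hx by auto; auto.
  - assert (G : U (fun a => forall c, c ∈ a -> W (fun k => P k a (b k (xi k) c)))).
    { apply (W_diag HU (P := fun c a => W (fun k => P k a (b k (xi k) c)))); intros c Hc.
      apply (H (fun k => b k (xi k) c)).
      refine (W_map3 HW (pr_and HW Hxi (pr_regular HW)) Hge (pr_above HW Hc) _).
      intros k [h1 h2] h3 h4; apply (proj1 Hb k (xi k)); auto. }
    refine (W_map2 HU G U_kappa _); intros a Ha HaK.
    refine (W_map2 HW (pr_complete HW (P := fun c k => P k a (b k (xi k) c)) HaK Ha) Hge _).
    intros k h h' x Hx; unfold canF in Hx; destruct (excluded_middle_informative _) as [h2|h2].
    + destruct (mem_irrefl (h' _ h2)).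
    + apply mem_image in Hx; destruct Hx as [c [Hc ->]]; auto.
Qed.

(** For levels of at least [k], the preimages of [x k] under the bijections lie below [k] and press
    down to a constant [c]; then every [a] above [c] serves. *)
Lemma UW_mem_canF xi x : adm xi -> W (fun k => x k ∈ xi k) ->
  UW (fun k a => x k ∈ canF b k (xi k) a).
Proof.
  intros Hxi Hx; destruct (adm_cases Hxi) as [[xi0 [Hx0 E]]|Hge].
  - refine (UW_map (UW_of_W (pr_and HW Hx (pr_and HW E (pr_above HW Hx0)))) _).
    intros k a [h [E' h']]; revert h'; rewrite E' in *; intros h'; rewrite canF_small; auto.
  - destruct (pr_press HW (P := fun c k => b k (xi k) c = x k)) as [c [Hc h]].
    + refine (W_map3 HW (pr_and HW Hxi (pr_regular HW)) Hge Hx _).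
      intros k [h1 h2] h3 h4; apply (proj1 Hb k (xi k)); auto.
    + refine (UW_map3 (UW_of_W h) (UW_of_W Hge) (UW_of_U (pr_above HU Hc)) _).
      intros k a E h1 h2; unfold canF; destruct (excluded_middle_informative _) as [h3|h3].
      * destruct (mem_irrefl (h1 _ h3)).
      * apply mem_image; exists c; auto.
Qed.

Lemma UW_ordset xi : adm xi ->
  UW (fun k a => ordset (canF b k (xi k) a) /\ canF b k (xi k) a ⊆ xi k).
Proof.
  intros H; refine (UW_map3 (UW_of_W H) (UW_of_W (pr_regular HW)) UW_mem _).
  intros k a h1 h2 h3; split; [apply canF_ordset | apply canF_sub]; tauto.
Qed.

(** Coherence of the canonical sets. Both inclusions are tested on families [x]; for the second,
    these are split according to whether [x k ∈ z k] for many [k]. *)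
Lemma UW_canF_initial xi z : adm xi -> W (fun k => z k ∈ xi k) ->
  UW (fun k a => canF b k (z k) a = sep (canF b k (xi k) a) (fun y => y ∈ z k)).
Proof.
  intros Hxi Hz; assert (Hz' := adm_mem Hxi Hz).
  refine (UW_map2 (UW_canF (P := fun k a x => x ∈ canF b k (xi k) a /\ x ∈ z k) Hz' _)
    (UW_canF (P := fun k a x => x ∈ z k -> x ∈ canF b k (z k) a) Hxi _) _).
  - intros x Hx; refine (UW_map2 (UW_mem_canF Hxi (x := x) _) (UW_of_W Hx) _); auto.
    refine (W_map3 HW Hx Hz Hxi _); intros k h1 h2 h3.
    exact (ordinal_sub (lt_plus_ordinal h3) h2 h1).
  - intros x Hx; destruct (pr_ultra HW (fun k => x k ∈ z k)) as [h|h].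
    + refine (UW_map (UW_mem_canF Hz' h) _); auto.
    + refine (UW_map (UW_of_W h) _); tauto.
  - intros k a h1 h2; apply mem_ext; intros y; rewrite mem_sep; split; auto.
    intros [h3 h4]; auto.
Qed.

(** Through this the component at [z k] of a restricted conjunction gets as its level exactly the
    index to which [z k] is collapsed, as [restr_ok] demands. *)
Lemma UW_canf_mem xi z : adm xi -> W (fun k => z k ∈ xi k) ->
  UW (fun k a => canf b k (z k) a = col (canF b k (xi k) a) (z k)).
Proof.
  intros Hxi Hz.
  refine (UW_map3 (UW_canF_initial Hxi Hz) (UW_mem_canF Hxi Hz) (UW_ordset Hxi) _).
  intros k a E h [h' _]; unfold canf; rewrite E; apply ot_initial; auto.
Qed.

Lemma UW_canf_succ z : adm (fun k => succ (z k)) ->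
  UW (fun k a => canf b k (succ (z k)) a = succ (canf b k (z k) a)).
Proof.
  intros Hxi; assert (Hz : W (fun k => z k ∈ succ (z k)))
    by (apply (W_all HW); intros k; apply mem_succ_self).
  refine (UW_map3 (UW_canF_initial Hxi Hz) (UW_mem_canF Hxi Hz)
    (UW_and (UW_ordset Hxi) (UW_of_W Hxi)) _).
  intros k a E h [[h1 h2] h3]; unfold canf; rewrite E; apply ot_add_max; auto.
Qed.

Lemma UW_canf_limit xi : adm xi -> W (fun k => limit (xi k)) ->
  UW (fun k a => limit (canf b k (xi k) a)).
Proof.
  intros Hxi Hl.
  assert (He : W (fun k => empty ∈ xi k))
    by (refine (W_map HW Hl _); intros k; apply empty_mem_limit).
  refine (UW_map3 (UW_canF (P := fun k a x => succ x ∈ canF b k (xi k) a) Hxi _)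
    (UW_mem_canF Hxi He) (UW_ordset Hxi) _).
  - intros x Hx; apply (UW_mem_canF (x := fun k => succ (x k)) Hxi).
    refine (W_map2 HW Hx Hl _); intros k h h'; apply h', h.
  - intros k a h1 h2 [h3 _]; apply ot_limit; auto.
    intros E; rewrite E in h2; destruct (mem_empty h2).
Qed.

End CanonicalFunctions.

(** * Infinitary formulas *)

(* The polarity [true] stands for Π, ∀ and ⋀, and [false] for Σ, ∃ and ⋁. *)
Definition Form (pol : bool) : V -> V -> fml -> Prop := if pol then Pi1 else Sigma1.
Definition Quant (pol : bool) : nat -> fml -> fml := if pol then All2 else Ex2.
Definition Quants (pol : bool) (ns : list nat) (phi : fml) : fml :=
  fold_right (Quant pol) phi ns.
Definition Big (pol : bool) : V -> (V -> fml) -> fml := if pol then Conj else Disj.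

Lemma Form_zero pol k p : fo_over k p -> Form pol k empty (Fo p).
Proof. destruct pol; constructor; auto. Qed.

Lemma Form_succ pol k xi ns psi :
  Form (negb pol) k xi psi -> Form pol k (succ xi) (Quants pol ns psi).
Proof. destruct pol; intros H; [apply Pi1_succ | apply Sigma1_succ]; exact H. Qed.

Lemma Form_limit pol k xi psi : limit xi -> fin2 (Big pol xi psi) ->
  (forall z, z ∈ xi -> Form pol k z (psi z)) -> Form pol k xi (Big pol xi psi).
Proof. destruct pol; constructor; auto. Qed.

Lemma Form_cases pol k xi phi : Form pol k xi phi ->
  (exists p, xi = empty /\ phi = Fo p /\ fo_over k p) \/
  (exists zeta ns psi, xi = succ zeta /\ phi = Quants pol ns psi /\
     Form (negb pol) k zeta psi) \/
  (exists psi, limit xi /\ fin2 (Big pol xi psi) /\ phi = Big pol xi psi /\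
     forall z, z ∈ xi -> Form pol k z (psi z)).
Proof.
  destruct pol; intros H; destruct H as [p Hp|zeta ns psi H|xi psi H1 H2 H3];
    [left|right; left|right; right|left|right; left|right; right].
  1, 4: exists p; auto.
  1, 3: exists zeta, ns, psi; auto.
  all: exists psi; auto.
Qed.

(** Induction on the level rather than on the derivation treats the mutually defined Π and Σ classes
    together, a successor step switching the polarity. *)
Lemma Form_ind (Q : bool -> V -> fml -> Prop) k :
  (forall pol p, fo_over k p -> Q pol empty (Fo p)) ->
  (forall pol xi ns psi, Form (negb pol) k xi psi -> Q (negb pol) xi psi ->
     Q pol (succ xi) (Quants pol ns psi)) ->
  (forall pol xi psi, limit xi -> (forall z, z ∈ xi -> Form pol k z (psi z)) ->
     (forall z, z ∈ xi -> Q pol z (psi z)) -> Q pol xi (Big pol xi psi)) ->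
  forall pol xi phi, Form pol k xi phi -> Q pol xi phi.
Proof.
  intros H0 H1 H2 pol xi; revert pol.
  induction xi as [xi IH] using (well_founded_ind mem_wf); intros pol phi H.
  apply Form_cases in H.
  destruct H as [[p [-> [-> Hp]]]|[[zeta [ns [psi [-> [-> H]]]]]|[psi [Hl [_ [-> H]]]]]]; auto.
  apply H1; auto; apply IH; auto using mem_succ_self.
Qed.

Lemma par2_Quants A pol ns phi : par2 A (Quants pol ns phi) <-> par2 A phi.
Proof. induction ns; [|destruct pol]; simpl in *; tauto. Qed.

Lemma free2_Quants n pol ns phi :
  free2 n (Quants pol ns phi) <-> ~ In n ns /\ free2 n phi.
Proof. induction ns; [|destruct pol]; simpl in *; intuition. Qed.

Lemma par2_Big A pol xi psi :
  par2 A (Big pol xi psi) <-> exists z, z ∈ xi /\ par2 A (psi z).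
Proof. destruct pol; reflexivity. Qed.

Lemma free2_Big n pol xi psi :
  free2 n (Big pol xi psi) <-> exists z, z ∈ xi /\ free2 n (psi z).
Proof. destruct pol; reflexivity. Qed.

Lemma cut_Quants a pol ns phi : cut a (Quants pol ns phi) = Quants pol ns (cut a phi).
Proof. induction ns; [|destruct pol]; simpl in *; congruence. Qed.

Lemma cut_Big a pol xi psi : cut a (Big pol xi psi) = Big pol xi (fun z => cut a (psi z)).
Proof. destruct pol; reflexivity. Qed.

Lemma par2_cut a A phi :
  par2 A (cut a phi) -> exists A', par2 A' phi /\ A = sep A' (inV a).
Proof.
  induction phi as [p| | |xi psi IH|xi psi IH]; simpl; auto using fo_par2_cut;
    intros [z [Hz H]]; destruct (IH z H) as [A' [h1 h2]]; exists A'; eauto.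
Qed.

Lemma free2_cut a n phi : free2 n (cut a phi) -> free2 n phi.
Proof.
  induction phi as [p| | |xi psi IH|xi psi IH]; simpl; try tauto.
  1: apply fo_free2_cut.
  all: intros [z [Hz H]]; eauto.
Qed.

(** * Truth and falsity of infinitary formulas *)

Definition holds (s : bool) (k : V) (e1 e2 : nat -> V) (phi : fml) : Prop :=
  if s then sat k e1 e2 phi else ~ sat k e1 e2 phi.

Lemma not_holds s k e1 e2 phi : ~ holds s k e1 e2 phi -> holds (negb s) k e1 e2 phi.
Proof. destruct s; simpl; tauto. Qed.

Lemma holds_negb s k e1 e2 phi : holds (negb s) k e1 e2 phi -> ~ holds s k e1 e2 phi.
Proof. destruct s; simpl; tauto. Qed.

Lemma holds_Fo s k e1 e2 p : holds s k e1 e2 (Fo p) = fo_holds s k e1 e2 p.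
Proof. destruct s; reflexivity. Qed.

Lemma holds_Quant s k e1 e2 pol n phi : holds s k e1 e2 (Quant pol n phi) <->
  if Bool.eqb pol s then forall A, subV k A -> holds s k e1 (update e2 n A) phi
  else exists A, subV k A /\ holds s k e1 (update e2 n A) phi.
Proof.
  destruct pol, s; simpl; try reflexivity; split.
  - intros H; apply NNPP; intros N; apply H; intros A HA; apply NNPP; eauto.
  - intros [A [HA HN]] H; auto.
  - intros H A HA N; eauto.
  - intros H [A [HA N]]; exact (H A HA N).
Qed.

Lemma holds_Big s k e1 e2 pol xi psi : holds s k e1 e2 (Big pol xi psi) <->
  if Bool.eqb pol s then forall z, z ∈ xi -> holds s k e1 e2 (psi z)
  else exists z, z ∈ xi /\ holds s k e1 e2 (psi z).
Proof.
  destruct pol, s; simpl; try reflexivity; split.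
  - intros H; apply NNPP; intros N; apply H; intros A HA; apply NNPP; eauto.
  - intros [A [HA HN]] H; auto.
  - intros H A HA N; eauto.
  - intros H [A [HA N]]; exact (H A HA N).
Qed.

(** * Restriction of a single formula *)

Section Restrictions.
Variable b : V -> V -> V -> V.
Hypothesis Hb : canonical_bijections b.

Lemma restr_Quants k a pol ns phi :
  restr b k a (Quants pol ns phi) = Quants pol ns (restr b k a phi).
Proof. induction ns; [|destruct pol]; simpl in *; congruence. Qed.

Lemma restr_ok_Quants k a pol ns phi :
  restr_ok b k a (Quants pol ns phi) <-> restr_ok b k a phi.
Proof. induction ns; [|destruct pol]; simpl in *; tauto. Qed.

Lemma restr_Big_small k a pol xi psi : xi ∈ k ->
  restr b k a (Big pol xi psi) = Big pol xi (fun z => cut a (psi z)).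
Proof.
  intros H; destruct pol; simpl; destruct (excluded_middle_informative _); tauto.
Qed.

Lemma restr_Big_large k a pol xi psi : xi ∉ k ->
  restr b k a (Big pol xi psi) =
  Big pol (canf b k xi a) (fun z => restr b k a (psi (canpi_inv b k xi a z))).
Proof.
  intros H; destruct pol; simpl; destruct (excluded_middle_informative _); tauto.
Qed.

Lemma restr_ok_Big k a pol xi psi : restr_ok b k a (Big pol xi psi) <->
  xi ∈ k \/ (regular k /\ forall z, z ∈ canf b k xi a ->
    restr_ok b k a (psi (canpi_inv b k xi a z)) /\
    Form pol a z (restr b k a (psi (canpi_inv b k xi a z)))).
Proof. destruct pol; reflexivity. Qed.

Lemma restr_small k a : ordinal k -> forall pol xi phi, Form pol k xi phi ->
  xi ∈ k -> restr b k a phi = cut a phi.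
Proof.
  intros Hk; apply (Form_ind (Q := fun _ xi phi => xi ∈ k -> restr b k a phi = cut a phi)).
  - reflexivity.
  - intros pol xi ns psi _ IH Hxi; rewrite restr_Quants, cut_Quants, IH; auto.
    exact (ordinal_sub Hk Hxi (mem_succ_self xi)).
  - intros pol xi psi _ _ _ Hxi; rewrite restr_Big_small, cut_Big; auto.
Qed.

(** Provides the finiteness clause for restricted limit formulas: reindexing only selects
    components, and cutting only replaces a parameter by its trace. *)
Lemma restr_par2_free2 k a : regular k -> a ⊆ k -> forall pol xi phi, Form pol k xi phi ->
  lt_plus xi k ->
  (forall A, par2 A (restr b k a phi) -> exists A', par2 A' phi /\ A = sep A' (inV a)) /\
  (forall n, free2 n (restr b k a phi) -> free2 n phi).
Proof.
  intros Hk Ha; apply (Form_ind (Q := fun _ xi phi => lt_plus xi k -> (forall A,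
    par2 A (restr b k a phi) -> exists A', par2 A' phi /\ A = sep A' (inV a)) /\
    (forall n, free2 n (restr b k a phi) -> free2 n phi))).
  - intros _ p _ _; split; [intros A; apply fo_par2_cut | intros n; apply fo_free2_cut].
  - intros pol xi ns psi _ IH Hxi.
    destruct (IH (lt_plus_mem Hxi (mem_succ_self xi))) as [IH1 IH2].
    rewrite restr_Quants; split.
    + intros A H; apply par2_Quants in H; destruct (IH1 A H) as [A' HA']; exists A'.
      rewrite par2_Quants; auto.
    + intros n; rewrite !free2_Quants; intuition.
  - intros pol xi psi _ _ IH Hxi; destruct (classic (xi ∈ k)) as [h|h].
    + rewrite restr_Big_small, <- cut_Big by auto; split; [intros A; apply par2_cut|].
      intros n; apply free2_cut.
    + rewrite restr_Big_large by auto.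
      assert (Hu : forall z, z ∈ canf b k xi a -> canpi_inv b k xi a z ∈ xi).
      { intros z Hz; apply (canF_sub Hb Hk Hxi Ha); unfold canpi_inv.
        apply uncollapse_spec; auto; apply (canF_ordset Hb); auto. }
      split.
      * intros A HA; apply par2_Big in HA; destruct HA as [z [Hz HA]].
        destruct (proj1 (IH _ (Hu z Hz) (lt_plus_mem Hxi (Hu z Hz))) A HA) as [A' [h1 h2]].
        exists A'; rewrite par2_Big; eauto.
      * intros n Hn; apply free2_Big in Hn; destruct Hn as [z [Hz Hn]]; apply free2_Big.
        exists (canpi_inv b k xi a z); split; auto.
        exact (proj2 (IH _ (Hu z Hz) (lt_plus_mem Hxi (Hu z Hz))) n Hn).
Qed.

Lemma fin2_restr k a pol xi phi : regular k -> a ⊆ k -> Form pol k xi phi ->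
  lt_plus xi k -> fin2 phi -> fin2 (restr b k a phi).
Proof.
  intros Hk Ha Hf Hxi [[l1 H1] [l2 H2]].
  destruct (restr_par2_free2 Hk Ha Hf Hxi) as [G1 G2]; split.
  - exists l1; auto.
  - exists (map (fun A => sep A (inV a)) l2); intros A HA.
    destruct (G1 A HA) as [A' [h ->]]; apply (in_map (fun A => sep A (inV a))); auto.
Qed.

(** Above [k], the component at [z] comes from the [x] that collapses to [z], and the last
    hypothesis identifies its level [canf b k x a] with [z]. Below [k], the canonical set is [xi]
    itself and nothing is reindexed. *)
Lemma restr_Big_Form k a pol xi psi : regular k -> lt_plus xi k -> a ⊆ k -> limit xi ->
  limit (canf b k xi a) -> fin2 (Big pol xi psi) ->
  (forall z, z ∈ xi -> Form pol k z (psi z)) ->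
  (forall x, x ∈ canF b k xi a -> (restr_ok b k a (psi x) /\
     Form pol a (canf b k x a) (restr b k a (psi x))) /\
     canf b k x a = col (canF b k xi a) x) ->
  restr_ok b k a (Big pol xi psi) /\
  Form pol a (canf b k xi a) (restr b k a (Big pol xi psi)).
Proof.
  intros Hk Hxi Ha Hl Hl' Hfin HF H.
  assert (Hfin' := fin2_restr Hk Ha (Form_limit Hl Hfin HF) Hxi Hfin).
  rewrite restr_ok_Big; destruct (classic (xi ∈ k)) as [h|h].
  - split; [auto|]; rewrite restr_Big_small in * by auto; rewrite canf_small in * by auto.
    apply Form_limit; auto; intros z Hz.
    assert (Hzk : z ∈ k) by exact (ordinal_sub (regular_ordinal Hk) h Hz).
    rewrite <- (restr_small a (regular_ordinal Hk) (HF z Hz) Hzk).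
    destruct (H z) as [[_ h1] _]; [rewrite canF_small; auto|].
    rewrite (canf_small b a Hk Hzk) in h1; exact h1.
  - assert (G : forall z, z ∈ canf b k xi a ->
        restr_ok b k a (psi (canpi_inv b k xi a z)) /\
        Form pol a z (restr b k a (psi (canpi_inv b k xi a z)))).
    { intros z Hz; destruct (uncollapse_spec (canF_ordset Hb Hk Hxi Ha) Hz) as [h1 h2].
      destruct (H _ h1) as [[h3 h4] h5]; rewrite h5, h2 in h4; auto. }
    split; [auto|]; rewrite restr_Big_large in * by auto; apply Form_limit; auto.
    intros z Hz; apply G, Hz.
Qed.

(** The collapse only renames indices, so for truth the components may be indexed by the canonical
    set itself. *)
Lemma holds_restr_Big s k a e1 e2 pol xi psi : regular k -> lt_plus xi k -> a ⊆ k ->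
  (forall z, z ∈ xi -> Form pol k z (psi z)) ->
  holds s a e1 e2 (restr b k a (Big pol xi psi)) <->
  if Bool.eqb pol s
  then forall x, x ∈ canF b k xi a -> holds s a e1 e2 (restr b k a (psi x))
  else exists x, x ∈ canF b k xi a /\ holds s a e1 e2 (restr b k a (psi x)).
Proof.
  intros Hk Hxi Ha HF; destruct (classic (xi ∈ k)) as [h|h].
  - rewrite restr_Big_small, holds_Big, canF_small by auto.
    assert (E : forall z, z ∈ xi -> restr b k a (psi z) = cut a (psi z)).
    { intros z Hz; apply (restr_small a (regular_ordinal Hk) (HF z Hz)).
      exact (ordinal_sub (regular_ordinal Hk) h Hz). }
    destruct (Bool.eqb pol s); split.
    + intros H x Hx; rewrite E; auto.
    + intros H x Hx; rewrite <- E; auto.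
    + intros [x [Hx H]]; exists x; rewrite E; auto.
    + intros [x [Hx H]]; exists x; rewrite <- E; auto.
  - assert (HO := canF_ordset Hb Hk Hxi Ha).
    rewrite restr_Big_large, holds_Big by auto; unfold canpi_inv, canf.
    destruct (Bool.eqb pol s); split.
    + intros H x Hx; destruct (uncollapse_surj HO Hx) as [z [Hz <-]]; auto.
    + intros H z Hz; apply H, uncollapse_spec; auto.
    + intros [z [Hz H]]; exists (uncollapse (canF b k xi a) z); split; auto.
      apply uncollapse_spec; auto.
    + intros [x [Hx H]]; destruct (uncollapse_surj HO Hx) as [z [Hz <-]]; eauto.
Qed.

(** * Restriction and reflection of families of formulas *)

Variables (kappa : V) (U W : (V -> Prop) -> Prop).
Hypotheses (HU : pressing kappa U) (HW : pressing kappa W).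
Hypothesis U_kappa : U (fun a => a ∈ kappa).

(** Induction along the well-founded descent of families of levels. The ultrafilter decides which
    formation rule applies, makes the quantifier prefix constant, and in the first-order case
    replaces the family by traces of one formula. *)
Lemma W_Form_ind (Q : bool -> (V -> V) -> (V -> fml) -> Prop) :
  (forall pol xi phi p, fo_over kappa p ->
     W (fun k => xi k = empty /\ phi k = Fo (cut_fo k p)) -> Q pol xi phi) ->
  (forall pol xi phi zeta ns psi, adm W xi ->
     W (fun k => xi k = succ (zeta k) /\ phi k = Quants pol ns (psi k)) ->
     Q (negb pol) zeta psi -> Q pol xi phi) ->
  (forall pol xi phi psi, adm W xi ->
     W (fun k => limit (xi k) /\ fin2 (Big pol (xi k) (psi k)) /\
       phi k = Big pol (xi k) (psi k) /\
       forall z, z ∈ xi k -> Form pol k z (psi k z)) ->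
     (forall z, W (fun k => z k ∈ xi k) -> Q pol z (fun k => psi k (z k))) ->
     Q pol xi phi) ->
  forall pol xi phi, adm W xi -> W (fun k => Form pol k (xi k) (phi k)) -> Q pol xi phi.
Proof.
  intros H0 H1 H2 pol xi; revert pol.
  induction xi as [xi IH] using (well_founded_ind (W_descent_wf HW)); intros pol phi Hxi HF.
  assert (HF' := W_map HW HF (fun k => @Form_cases pol k (xi k) (phi k))).
  simpl in HF'; apply (W_or HW) in HF'; destruct HF' as [C|C].
  - apply (W_choice HW) in C; destruct C as [p Hp].
    destruct (W_fo HW (p := p)) as [p0 [h1 h2]].
    { refine (W_map HW Hp _); intros k; tauto. }
    apply (H0 pol xi phi p0 h1); refine (W_map2 HW Hp h2 _).
    intros k [E1 [E2 _]] E3; rewrite E2, E3; auto.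
  - apply (W_or HW) in C; destruct C as [C|C].
    + apply (W_choice HW) in C; destruct C as [zeta C].
      apply (W_choice HW) in C; destruct C as [ns C].
      apply (W_choice HW) in C; destruct C as [psi C].
      destruct (W_list HW ns) as [ns0 Hns].
      assert (Hz : W (fun k => zeta k ∈ xi k)).
      { refine (W_map HW C _); intros k [-> _]; apply mem_succ_self. }
      apply (H1 pol xi phi zeta ns0 psi Hxi).
      * refine (W_map2 HW C Hns _); intros k [E1 [E2 _]] <-; auto.
      * apply IH; [exact Hz | exact (adm_mem HW Hxi Hz) |].
        refine (W_map HW C _); tauto.
    + apply (W_choice HW) in C; destruct C as [psi C].
      apply (H2 pol xi phi psi Hxi C); intros z Hz.
      apply IH; [exact Hz | exact (adm_mem HW Hxi Hz) |].
      refine (W_map2 HW C Hz _); intros k [_ [_ [_ h]]] h'; auto.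
Qed.

(** Modulo the ultrafilters the canonical functions respect zero, successors and limits, so levels
    change under restriction as the formation rules require. *)
Lemma UW_restr_Form pol xi phi : adm W xi -> W (fun k => Form pol k (xi k) (phi k)) ->
  UW U W (fun k a => restr_ok b k a (phi k) /\
    Form pol a (canf b k (xi k) a) (restr b k a (phi k))).
Proof.
  revert pol xi phi; apply W_Form_ind.
  - intros pol xi phi p Hp H.
    refine (UW_map3 HU HW (UW_of_W HU (pr_and HW H (pr_regular HW)))
      (UW_mem HU HW U_kappa) (UW_of_U HU HW (W_fo_over HU Hp)) _).
    intros k a [[-> ->] Hk] [Ha1 Ha2] Ho; simpl; split; [exact I|].
    assert (He : empty ∈ k) by apply Hk, (of_nat_omega 0).
    rewrite canf_small, cut_fo_cut_fo by auto; apply Form_zero, Ho.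
  - intros pol xi phi zeta ns psi Hxi H IH.
    assert (Hs : adm W (fun k => succ (zeta k))).
    { refine (W_map2 HW Hxi H _); intros k h [<- _]; exact h. }
    refine (UW_map3 HU HW (UW_of_W HU H) IH (UW_canf_succ Hb HU HW U_kappa Hs) _).
    intros k a [-> ->] [h1 h2] E; rewrite E, restr_ok_Quants, restr_Quants; split; auto.
    apply Form_succ, h2.
  - intros pol xi phi psi Hxi H IH.
    assert (Hl : W (fun k => limit (xi k))) by (refine (W_map HW H _); tauto).
    refine (UW_map3 HU HW (UW_of_W HU (pr_and HW H (pr_and HW Hxi (pr_regular HW))))
      (UW_and HU HW (UW_mem HU HW U_kappa) (UW_canf_limit Hb HU HW U_kappa Hxi Hl))
      (UW_canF Hb HU HW U_kappa (P := fun k a x => (restr_ok b k a (psi k x) /\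
        Form pol a (canf b k x a) (restr b k a (psi k x))) /\
        canf b k x a = col (canF b k (xi k) a) x) Hxi _) _).
    + intros x Hx.
      exact (UW_and HU HW (IH x Hx) (UW_canf_mem Hb HU HW U_kappa Hxi Hx)).
    + intros k a [[h1 [h2 [-> h3]]] [h4 h5]] [[h6 h7] h8] h9; apply restr_Big_Form; auto.
Qed.

(** Assignments live over V_κ, their second-order values being read over V_k and V_a through traces.
    As both signs are covered, the implication amounts to an equivalence. *)
Definition reflects (phi : V -> fml) : Prop :=
  forall s e1 e2, env_over kappa e1 e2 ->
    W (fun k => holds s k e1 (cut_env k e2) (phi k)) ->
    UW U W (fun k a => holds s a e1 (cut_env a e2) (restr b k a (phi k))).

Lemma reflects_ext phi psi : W (fun k => phi k = psi k) -> reflects psi -> reflects phi.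
Proof.
  intros E H s e1 e2 He Hs.
  refine (UW_map2 HU HW (UW_of_W HU E) (H s e1 e2 He _) _).
  - refine (W_map2 HW E Hs _); intros k <-; auto.
  - intros k a <-; auto.
Qed.

(* A false instance over [V_a], for [U]-many [a], is glued to a false instance over [V_κ]. *)
Lemma reflects_Quant pol n psi :
  reflects psi -> reflects (fun k => Quant pol n (psi k)).
Proof.
  intros IH s e1 e2 He H.
  assert (E : forall k a, restr b k a (Quant pol n (psi k)) = Quant pol n (restr b k a (psi k)))
    by (destruct pol; reflexivity).
  destruct (Bool.eqb pol s) eqn:Eps.
  - apply NNPP; intros N; apply (W_not HU) in N.
    destruct (W_glue HU (P := fun X a => W (fun k =>
      holds (negb s) a e1 (update (cut_env a e2) n X) (restr b k a (psi k))))) as [X [HX G]].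
    { refine (W_map2 HU N U_kappa _); intros a Na Ha; apply (W_not HW) in Na.
      (* For fixed [a] the subset of V_a giving the opposite sign may depend on [k]; since [a < κ],
         one subset serves for many [k]. *)
      apply (W_some_subV HW (P := fun X k =>
        holds (negb s) a e1 (update (cut_env a e2) n X) (restr b k a (psi k))) Ha).
      refine (W_map HW Na _); intros k Nk; rewrite E, holds_Quant, Eps in Nk.
      apply NNPP; intros h; apply Nk; intros A HA; apply NNPP; intros h'; apply h.
      exists A; split; auto using not_holds. }
    assert (G' := IH s e1 (update e2 n X) (env_over_update2 n He HX)).
    refine (pr_false HU (W_map2 HU G (G' _) _)).
    + refine (W_map HW H _); intros k Hk; rewrite holds_Quant, Eps in Hk.
      rewrite cut_env_update; apply Hk, subV_cut.
    + intros a h1 h2; refine (pr_false HW (W_map2 HW h1 h2 _)); intros k h3 h4.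
      rewrite cut_env_update in h4; exact (holds_negb h3 h4).
  (* In the existential case the witnesses over V_k are glued to [X], whose trace on V_a is a
     witness over V_a. *)
  - destruct (W_glue HW (P := fun X k =>
      holds s k e1 (update (cut_env k e2) n X) (psi k))) as [X [HX G]].
    { refine (W_map HW H _); intros k Hk; rewrite holds_Quant, Eps in Hk; exact Hk. }
    refine (UW_map HU HW (IH s e1 (update e2 n X) (env_over_update2 n He HX) _) _).
    + refine (W_map HW G _); intros k; rewrite cut_env_update; auto.
    + intros k a h; rewrite E, holds_Quant, Eps; rewrite cut_env_update in h.
      eauto using subV_cut.
Qed.

Lemma reflects_Quants pol ns psi :
  reflects psi -> reflects (fun k => Quants pol ns (psi k)).
Proof.
  intros H; induction ns as [|n ns IH]; [exact H|].
  exact (@reflects_Quant pol n (fun k => Quants pol ns (psi k)) IH).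
Qed.

Lemma reflects_Form pol xi phi :
  adm W xi -> W (fun k => Form pol k (xi k) (phi k)) -> reflects phi.
Proof.
  revert pol xi phi; apply W_Form_ind.
  - intros pol xi phi p Hp H; apply reflects_ext with (fun k => Fo (cut_fo k p)).
    { refine (W_map HW H _); tauto. }
    intros s e1 e2 He Hs.
    (* First-order truth is transferred up from V_k to V_κ along [W], and then down to V_a along
       [U]. *)
    assert (Hs' : fo_holds s kappa e1 e2 p).
    { apply (fo_los_conv HW Hp He); refine (W_map HW Hs _); intros k; rewrite holds_Fo; auto. }
    refine (UW_map2 HU HW (UW_of_U HU HW (fo_los HU Hp He Hs')) (UW_mem HU HW U_kappa) _).
    intros k a h [_ Ha]; simpl restr; rewrite cut_fo_cut_fo, holds_Fo; auto.
  - intros pol xi phi zeta ns psi _ H IH.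
    apply reflects_ext with (fun k => Quants pol ns (psi k)); [|apply reflects_Quants, IH].
    refine (W_map HW H _); tauto.
  - intros pol xi phi psi Hxi H IH.
    apply reflects_ext with (fun k => Big pol (xi k) (psi k)).
    { refine (W_map HW H _); tauto. }
    intros s e1 e2 He Hs.
    assert (G : UW U W (fun k a => if Bool.eqb pol s
      then forall x, x ∈ canF b k (xi k) a ->
        holds s a e1 (cut_env a e2) (restr b k a (psi k x))
      else exists x, x ∈ canF b k (xi k) a /\
        holds s a e1 (cut_env a e2) (restr b k a (psi k x)))).
    { destruct (Bool.eqb pol s) eqn:Eps.
      - apply (UW_canF Hb HU HW U_kappa (P := fun k a x =>
          holds s a e1 (cut_env a e2) (restr b k a (psi k x))) Hxi).
        intros x Hx; apply (IH x Hx s e1 e2 He); refine (W_map2 HW Hs Hx _); intros k h h'.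
        rewrite holds_Big, Eps in h; auto.
      (* The chosen indices form one family; the induction hypothesis applies to it, and its values
         lie in the canonical sets for almost all pairs. *)
      - destruct (W_choice HW (P := fun k z => z ∈ xi k /\
          holds s k e1 (cut_env k e2) (psi k z))) as [z Hz].
        { refine (W_map HW Hs _); intros k h; rewrite holds_Big, Eps in h; exact h. }
        assert (Hz1 : W (fun k => z k ∈ xi k)) by (refine (W_map HW Hz _); tauto).
        refine (UW_map2 HU HW (UW_mem_canF Hb HU HW Hxi Hz1) (IH z Hz1 s e1 e2 He _) _).
        + refine (W_map HW Hz _); tauto.
        + eauto. }
    refine (UW_map3 HU HW G (UW_of_W HU (pr_and HW H (pr_and HW Hxi (pr_regular HW))))
      (UW_mem HU HW U_kappa) _).
    intros k a h [[_ [_ [_ h1]]] [h2 h3]] [_ h4]; apply holds_restr_Big; auto.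
Qed.

Theorem UW_reflection (xi : V -> V) (phi : V -> fml) :
  adm W xi -> W (fun k => Pi1 k (xi k) (phi k)) -> W (fun k => models k (phi k)) ->
  UW U W (fun k a => restr_defined b k a (phi k) /\ formula_over a (restr b k a (phi k)) /\
    models a (restr b k a (phi k))).
Proof.
  intros Hxi HF Hm.
  (* [models] assigns [empty] to every variable, and cutting to V_k leaves this assignment
     unchanged. *)
  assert (E : forall k, cut_env k (fun _ => empty) = fun _ => empty).
  { intros k; extensionality n; apply cut_subV; intros x Hx; destruct (mem_empty Hx). }
  assert (He : env_over kappa (fun _ => empty) (fun _ => empty)).
  { intros n; split; [|intros x Hx; destruct (mem_empty Hx)].
    apply inV_iff; exists omega; split; [apply (pr_omega HW)|].
    intros x Hx; destruct (mem_empty Hx). }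
  refine (UW_map3 HU HW (UW_restr_Form (pol := true) Hxi HF)
    (reflects_Form (pol := true) Hxi HF (s := true) He _)
    (UW_and HU HW (UW_mem HU HW U_kappa) (UW_of_U HU HW (pr_regular HU))) _).
  - refine (W_map HW Hm _); intros k; rewrite E; auto.
  - intros k a [h1 h2] h3 [[h4 _] h5]; rewrite E in h3.
    split; [exact (conj h4 (conj h5 h1)) | split; [|exact h3]].
    exists (canf b k (xi k) a); left; exact h2.
Qed.

End Restrictions.

(** * The two ultrafilters and the theorem *)

(** Reads [U] as an ultrafilter on properties, giving it the same type as the principal ultrafilter
    at κ. *)
Definition measure_filter (kappa U : V) (P : V -> Prop) : Prop := sep kappa P ∈ U.

Section Measure.
Variables kappa U : V.
Hypotheses (Hk : measurable kappa) (HU : normal_measure kappa U).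

Notation M := (measure_filter kappa U).

Lemma measurable_ordinal : ordinal kappa.
Proof. apply Hk. Qed.

Lemma M_mono (P Q : V -> Prop) : M P -> (forall x, x ∈ kappa -> P x -> Q x) -> M Q.
Proof.
  intros H1 H2; destruct HU as [[_ [_ [_ [Hm _]]]] _]; apply Hm with (sep kappa P); auto.
  - intros x Hx; apply mem_sep in Hx; apply mem_sep; split; [tauto | apply H2; tauto].
  - intros x Hx; apply mem_sep in Hx; tauto.
Qed.

Lemma M_complete c (P : V -> V -> Prop) : c ∈ kappa ->
  (forall x, x ∈ c -> M (P x)) -> M (fun k => forall x, x ∈ c -> P x k).
Proof.
  intros Hc H; destruct HU as [[_ [_ [_ [_ [_ Hcomp]]]]] _].
  refine (M_mono (P := fun k => forall x, x ∈ c -> k ∈ sep kappa (P x)) (Hcomp c _ Hc H) _).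
  intros k _ h x Hx; specialize (h x Hx); apply mem_sep in h; tauto.
Qed.

Lemma M_diag (P : V -> V -> Prop) : (forall c, c ∈ kappa -> M (P c)) ->
  M (fun k => forall c, c ∈ k -> P c k).
Proof.
  intros H; destruct HU as [_ [_ Hd]].
  refine (M_mono (P := fun k => forall c, c ∈ k -> k ∈ sep kappa (P c)) (Hd _ H) _).
  intros k _ h x Hx; specialize (h x Hx); apply mem_sep in h; tauto.
Qed.

Lemma M_ultra (P : V -> Prop) : M P \/ M (fun k => ~ P k).
Proof.
  destruct HU as [[_ [_ [_ [_ [Hu _]]]]] _].
  destruct (Hu (sep kappa P)) as [h|h]; [intros x Hx; apply mem_sep in Hx; tauto|auto|right].
  refine (M_mono (P := fun x => x ∉ sep kappa P) h _).
  intros x Hx h'; rewrite mem_sep in h'; tauto.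
Qed.

Lemma M_false : ~ M (fun _ => False).
Proof.
  intros H; destruct HU as [[_ [_ [He _]]] _]; apply He.
  replace empty with (sep kappa (fun _ => False)); [exact H|].
  apply mem_ext; intros x; rewrite mem_sep; split; [tauto | intros h; destruct (mem_empty h)].
Qed.

Lemma M_and (P Q : V -> Prop) : M P -> M Q -> M (fun k => P k /\ Q k).
Proof.
  intros HP HQ; assert (H2 : of_nat 2 ∈ kappa).
  { exact (ordinal_sub measurable_ordinal (proj1 (proj2 Hk)) (of_nat_omega 2)). }
  (* Binary intersections come from completeness over the index set 2 = {0, 1}. *)
  refine (M_mono (M_complete
    (P := fun x k => (x = of_nat 0 -> P k) /\ (x = of_nat 1 -> Q k)) H2 _) _).
  - intros x Hx; simpl in Hx; apply mem_succ in Hx; destruct Hx as [Hx| ->].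
    + apply mem_succ in Hx; destruct Hx as [Hx| ->]; [destruct (mem_empty Hx)|].
      refine (M_mono HP _); intros k _ h; split; auto.
      intros E; apply (of_nat_inj (m := 0) (n := 1)) in E; discriminate.
    + refine (M_mono HQ _); intros k _ h; split; auto.
      intros E; apply (of_nat_inj (m := 1) (n := 0)) in E; discriminate.
  - intros k _ h; split; [apply (h (of_nat 0)) | apply (h (of_nat 1))]; auto;
      simpl; rewrite !mem_succ; auto.
Qed.

Lemma M_all (P : V -> Prop) : (forall x, x ∈ kappa -> P x) -> M P.
Proof.
  intros H; destruct (M_ultra P) as [h|h]; auto; destruct M_false.
  refine (M_mono h _); intros x Hx h'; exact (h' (H x Hx)).
Qed.

Lemma M_ex (P : V -> Prop) : M P -> exists x, x ∈ kappa /\ P x.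
Proof.
  intros H; apply NNPP; intros N; apply M_false; refine (M_mono H _); eauto.
Qed.

Lemma M_press (P : V -> V -> Prop) : M (fun k => exists c, c ∈ k /\ P c k) ->
  exists c, c ∈ kappa /\ M (P c).
Proof.
  intros H; apply NNPP; intros N.
  assert (D : M (fun k => forall c, c ∈ k -> ~ P c k)).
  { apply (M_diag (P := fun c k => ~ P c k)); intros c Hc; destruct (M_ultra (P c)); auto.
    exfalso; eauto. }
  destruct (M_ex (M_and H D)) as [k [_ [[c [Hc h]] h']]]; exact (h' c Hc h).
Qed.

(** Nonprincipality and completeness exclude all values up to [c], and trichotomy leaves only larger
    ones. *)
Lemma M_above c : c ∈ kappa -> M (fun k => c ∈ k).
Proof.
  intros Hc; assert (Hne : forall x, x ∈ kappa -> M (fun k => k <> x)).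
  { intros x Hx; destruct (M_ultra (fun k => k = x)) as [h|h]; auto; exfalso.
    destruct HU as [_ [Hn _]]; apply (Hn x Hx).
    replace (singleton x) with (sep kappa (fun k => k = x)); [exact h|].
    apply mem_ext; intros z; rewrite mem_sep, mem_singleton; split; [tauto|].
    intros ->; auto. }
  refine (M_mono (M_and (M_complete (P := fun x k => k <> x) Hc _) (Hne c Hc)) _).
  - intros x Hx; exact (Hne x (ordinal_sub measurable_ordinal Hc Hx)).
  - intros k Hkk [h1 h2].
    destruct (ordinal_trichotomy (ordinal_mem measurable_ordinal Hc)
      (ordinal_mem measurable_ordinal Hkk)) as [h|[h|h]]; auto.
    + congruence.
    + destruct (h1 k h eq_refl).
Qed.

Lemma measurable_succ c : c ∈ kappa -> succ c ∈ kappa.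
Proof.
  intros Hc; destruct (M_ex (M_above Hc)) as [k [Hkk Hck]].
  pose proof (ordinal_mem measurable_ordinal Hkk) as Hok.
  destruct (ordinal_trichotomy (ordinal_succ (ordinal_mem Hok Hck)) Hok) as [h|[->|h]]; auto.
  - exact (ordinal_sub measurable_ordinal Hkk h).
  - apply mem_succ in h; destruct h as [h| ->]; [destruct (mem_asym h Hck)|].
    destruct (mem_irrefl Hck).
Qed.

Lemma measurable_omega_sub : omega ⊆ kappa.
Proof. apply ordinal_sub; [apply measurable_ordinal | apply Hk]. Qed.

Lemma measurable_regular : regular kappa.
Proof.
  split; [apply Hk | split; [apply measurable_omega_sub|]]; intros a f Ha Hf.
  destruct (M_ex (M_complete (P := fun x k => f x ∈ k) Ha (fun x Hx => M_above (Hf x Hx))))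
    as [c [Hc h]]; eauto.
Qed.

(** A bijection from a smaller ordinal onto [k] would be unbounded in [k], so the cofinality
    condition already makes [k] a cardinal. *)
Lemma regular_of_cofinality k : ordinal k -> omega ⊆ k ->
  (forall (a : V) (f : V -> V), a ∈ k -> (forall x, x ∈ a -> f x ∈ k) ->
    exists c, c ∈ k /\ forall x, x ∈ a -> f x ∈ c) -> regular k.
Proof.
  intros Ho Hw H; split; [split; [exact Ho|] | auto]; intros a Ha [f [H1 [_ H3]]].
  destruct (H a f Ha H1) as [c [Hc h]]; destruct (H3 c Hc) as [x [Hx <-]].
  exact (mem_irrefl (h x Hx)).
Qed.

(* If almost all [k] were singular, pressing down would fix first their
   domain and then each of their values, making a single map cofinal in many [k]. *)
Lemma M_regular : M regular.
Proof.
  set (bad a f k := (forall x, x ∈ a -> f x ∈ k) /\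
    ~ exists c, c ∈ k /\ forall x, x ∈ a -> f x ∈ c).
  destruct (M_ultra regular) as [h|N]; auto; exfalso.
  assert (B : M (fun k => exists a, a ∈ k /\ exists f : V -> V, bad a f k)).
  { refine (M_mono (M_and N (M_above (proj1 (proj2 Hk)))) _); intros k Hkk [h1 h2].
    pose proof (ordinal_mem measurable_ordinal Hkk) as Ho.
    apply NNPP; intros h; apply h1, regular_of_cofinality; auto.
    - exact (ordinal_sub Ho h2).
    - intros a f Ha Hf; apply NNPP; intros h'; apply h; exists a; split; auto.
      exists f; split; auto. }
  apply M_press in B; destruct B as [a [Ha B]].
  set (f k := epsilon (inhabits (fun x : V => x)) (fun f => bad a f k)).
  assert (F : M (fun k => bad a (f k) k)).
  { refine (M_mono B _); intros k _ h.
    exact (epsilon_spec (inhabits (fun x : V => x)) (fun f => bad a f k) h). }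
  assert (C : forall x, x ∈ a -> exists c, c ∈ kappa /\ M (fun k => f k x = c)).
  { intros x Hx; apply (M_press (P := fun c k => f k x = c)); refine (M_mono F _).
    intros k _ [h _]; eauto. }
  set (g x := epsilon (inhabits empty) (fun c => c ∈ kappa /\ M (fun k => f k x = c))).
  assert (G : forall x, x ∈ a -> g x ∈ kappa /\ M (fun k => f k x = g x)).
  { intros x Hx; apply (epsilon_spec (inhabits empty)
      (fun c => c ∈ kappa /\ M (fun k => f k x = c))), C, Hx. }
  (* Regularity of κ bounds the stabilised map [g] by some [c < κ], which then bounds [f k] in every
     [k > c] where the two agree on [a]. *)
  destruct (proj2 (proj2 measurable_regular) a g Ha (fun x Hx => proj1 (G x Hx)))
    as [c [Hc Hgc]].
  destruct (M_ex (M_and F (M_and (M_above Hc) (M_complete (P := fun x k => f k x = g x) Ha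
    (fun x Hx => proj2 (G x Hx)))))) as [k [_ [[_ h1] [h2 h3]]]].
  apply h1; exists c; split; auto; intros x Hx; rewrite h3; auto.
Qed.

Lemma measure_pressing : pressing kappa M.
Proof.
  split.
  - apply measurable_ordinal.
  - apply Hk.
  - apply measurable_succ.
  - intros P Q H HP; refine (M_mono HP _); auto.
  - apply M_and.
  - apply M_ultra.
  - apply M_false.
  - apply M_complete.
  - apply M_above.
  - apply M_all; intros x Hx; apply mem_succ; auto.
  - apply M_regular.
  - apply M_press.
Qed.

(** At a single point the filter clauses and pressing down are immediate; the substance is that κ is
    a regular limit ordinal above ω. *)
Lemma principal_pressing : pressing kappa (fun P => P kappa).
Proof.
  split; auto.
  - apply measurable_ordinal.
  - apply Hk.
  - apply measurable_succ.
  - intros P; apply classic.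
  - apply mem_succ_self.
  - apply measurable_regular.
Qed.

(** * Indescribability of κ and of almost all smaller cardinals *)

Variable b : V -> V -> V -> V.
Hypothesis Hb : canonical_bijections b.

Lemma measurable_indescribable xi : lt_plus xi kappa -> indescribable b kappa xi.
Proof.
  intros Hxi; split; [apply Hk | split; [exact Hxi | split; [intros x; auto|]]].
  intros phi HF _ Hm.
  destruct (M_ex (UW_reflection Hb measure_pressing principal_pressing (M_all (fun x Hx => Hx))
    (xi := fun _ => xi) (phi := fun _ => phi) Hxi HF Hm)) as [a [Ha h]]; eauto.
Qed.

Lemma M_indescribable :
  M (fun a => forall xi, lt_plus xi a -> indescribable b a xi).
Proof.
  destruct (M_ultra (fun a => forall xi, lt_plus xi a -> indescribable b a xi)) as [h|N];
    auto; exfalso.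
  set (bad k xi phi := lt_plus xi k /\ Pi1 k xi phi /\ models k phi /\
    forall a, a ∈ k -> ~ (restr_defined b k a phi /\ formula_over a (restr b k a phi) /\
      models a (restr b k a phi))).
  pose proof measure_pressing as HM.
  assert (B : M (fun k => exists xi phi, bad k xi phi)).
  { refine (M_mono (M_and N M_regular) _); intros k _ [h Hr].
    apply not_all_ex_not in h; destruct h as [xi h]; apply imply_to_and in h.
    destruct h as [Hxi h]; exists xi; apply NNPP; intros h'; apply h.
    split; [apply Hr | split; [exact Hxi | split; [intros x; auto|]]].
    intros phi HF _ Hm; apply NNPP; intros h''; apply h'; exists phi.
    split; [exact Hxi | split; [exact HF | split; [exact Hm|]]].
    intros a Ha h3; apply h''; eauto. }
  apply (W_choice HM) in B; destruct B as [xi B].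
  apply (W_choice HM) in B; destruct B as [phi B].
  assert (R := UW_reflection Hb HM HM (M_all (fun x Hx => Hx)) (xi := xi) (phi := phi)
    (M_mono B (fun k _ h => proj1 h)) (M_mono B (fun k _ h => proj1 (proj2 h)))
    (M_mono B (fun k _ h => proj1 (proj2 (proj2 h))))).
  (* The outer filter yields one [a] to which many [φ_k] reflect; among these [k] there is one above
     [a] at which [φ_k] is a counterexample. *)
  destruct (M_ex R) as [a [Ha Ra]].
  destruct (M_ex (M_and (M_above Ha) (M_and B Ra))) as [k [_ [h1 [[_ [_ [_ h2]]] h3]]]].
  exact (h2 a h1 h3).
Qed.

End Measure.

Theorem proposition3p10 (b : V -> V -> V -> V) (Hb : canonical_bijections b)
    (kappa U : V) (Hkappa : measurable kappa) (HU : normal_measure kappa U) :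
  (forall xi, lt_plus xi kappa -> indescribable b kappa xi) /\
  sep kappa (fun alpha => forall xi, lt_plus xi alpha -> indescribable b alpha xi) ∈ U.
Proof.
  split.
  - intros xi; exact (measurable_indescribable Hkappa HU Hb (xi := xi)).
  - exact (M_indescribable Hkappa HU Hb).
Qed.
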